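(* Let $X$ be a complex projective variety with canonical singularities. Let $H$ be any effective Cartier divisor on $X$ and assume that there exists an integer $m_0\ge 1$ such that $H^0(X,H+mK_X)=0$ for every integer $m\ge m_0$. Then $X$ has negative Kodaira dimension.
   Context: Varieties are normal. $K_X$ is the canonical divisor. For a Weil divisor $D$, $H^0(X,D)=H^0(X,\mathcal{O}_X(D))$, with $\mathcal{O}_X(D)$ the associated rank-one reflexive sheaf. $X$ has canonical singularities if $K_X$ is $\mathbb{Q}$-Cartier and $\nu_*\mathcal{O}_{\tilde X}(mK_{\tilde X})=\mathcal{O}_X(mK_X)$ (for all $m\geq 1$) for one (equivalently, any) resolution $\nu:\tilde X\to X$. The Kodaira dimension of a singular variety $X$ is by definition that of any smooth projective model $\tilde X$; it is negative if $H^0(\tilde X,nK_{\tilde X})=0$ for all $n\ge 1$. *)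

(* Defs.v *)
From HB Require Import structures.
From mathcomp Require Export all_boot all_order all_algebra.
From mathcomp Require Export mathcomp_extra boolp classical_sets functions.
From mathcomp Require Export cardinality reals.
From mathcomp.real_closed Require Export complex.
From mathcomp Require Export mpoly.

Set Implicit Arguments.
Unset Strict Implicit.
Unset Printing Implicit Defensive.

Import Order.TTheory GRing.Theory Num.Theory.
Local Open Scope classical_set_scope.
Local Open Scope ring_scope.

(* The base field k is meant to be algebraically closed of characteristic 0.
   Varieties are handled inside their function field.  A projective variety
   over k with function field K (an extension iota : k -> K) is the closure in
   P^N of its generic point (x_0 : ... : x_N), a point with coordinates in K
   whose ratios generate K over k.  Every integral closed subscheme of P^N_k
   arises in this way, from its function field and its generic point.

   A scheme-theoretic point is identified with its local ring, a subring of K;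
   this loses nothing since a projective variety is separated.  Rational
   functions, rational differential forms, Weil divisors and the sheaves
   O_X(D) all live in K, and a birational map between two varieties is an
   identification of their function fields. *)

Definition ideal_of (K : fieldType) (A I : set K) : Prop :=
  [/\ I `<=` A, I 0, (forall a b, I a -> I b -> I (a + b))
    & forall a b, A a -> I b -> I (a * b)].

Definition prime_ideal (K : fieldType) (A p : set K) : Prop :=
  [/\ ideal_of A p, ~ p 1
    & forall a b, A a -> A b -> p (a * b) -> p a \/ p b].

Definition maximal_ideal (K : fieldType) (A m : set K) : Prop :=
  [/\ ideal_of A m, ~ m 1
    & forall I, ideal_of A I -> ~ I 1 -> m `<=` I -> I = m].

Definition localization (K : fieldType) (A p : set K) : set K :=
  [set y | exists a s, [/\ A a, A s, ~ p s & y = a / s]].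

Definition unit_in (K : fieldType) (O : set K) (a : K) : Prop :=
  [/\ a != 0, O a & O a^-1].

Definition nonunits (K : fieldType) (O : set K) : set K :=
  [set a | O a /\ ~ unit_in O a].

Definition integrally_closed (K : fieldType) (O : set K) : Prop :=
  forall (f : K) (q : {poly K}),
    q \is monic -> (forall i, O q`_i) -> root q f -> O f.

Definition dominates (K : fieldType) (O' O : set K) : Prop :=
  O `<=` O' /\ nonunits O = O `&` nonunits O'.

(* The order of f != 0 along a discrete valuation ring O; a junk value for
   f = 0, or if O is not a discrete valuation ring. *)
Definition ord (K : fieldType) (O : set K) (f : K) : int :=
  xget 0 [set n : int | exists u t : K,
    [/\ unit_in O u, t != 0, nonunits O = [set t * a | a in O]
      & f = u * t ^ n]].

Definition alg_independent (k K : fieldType) (iota : {rmorphism k -> K})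
    (d : nat) (t : 'I_d -> K) : Prop :=
  forall p : {mpoly k[d]}, mmap iota t p = 0 -> p = 0.

Definition transcendence_degree (k K : fieldType) (iota : {rmorphism k -> K})
    (d : nat) : Prop :=
  (exists t : 'I_d -> K, alg_independent iota t) /\
  (forall t : 'I_d.+1 -> K, ~ alg_independent iota t).

Definition derivation (k K : fieldType) (iota : {rmorphism k -> K})
    (D : K -> K) : Prop :=
  [/\ forall c, D (iota c) = 0,
      forall a b, D (a + b) = D a + D b
    & forall a b, D (a * b) = a * D b + b * D a].

Definition vector_field (k K : fieldType) (iota : {rmorphism k -> K}) : Type :=
  {D : K -> K | derivation iota D}.

(* The exterior power of degree d of the Kaehler differentials of K over k is
   realized as a space of alternating d-forms on the derivations of K over k:
   in characteristic 0, for K finitely generated over k, the differentials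
   form a finite-dimensional space, with dual the space of derivations. *)
Definition diff_form (k K : fieldType) (iota : {rmorphism k -> K})
    (d : nat) : Type :=
  ('I_d -> vector_field iota) -> K.

(* da_1 /\ ... /\ da_d evaluates on D_1, ..., D_d to det (D_i a_j). *)
Definition dwedge (k K : fieldType) (iota : {rmorphism k -> K}) (d : nat)
    (a : 'I_d -> K) : diff_form iota d :=
  fun D => \det (\matrix_(i < d, j < d) sval (D i) (a j)).
Arguments dwedge {k K} iota {d} a D.

Definition scale_form (k K : fieldType) (iota : {rmorphism k -> K}) (d : nat)
    (g : K) (w : diff_form iota d) : diff_form iota d :=
  fun D => g * w D.

Definition rational_form (k K : fieldType) (iota : {rmorphism k -> K})
    (d : nat) (w : diff_form iota d) : Prop :=
  exists s : seq (K * ('I_d -> K)),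
    w = fun D => \sum_(ga <- s) ga.1 * dwedge iota ga.2 D.

Definition nonzero_form (k K : fieldType) (iota : {rmorphism k -> K})
    (d : nat) (w : diff_form iota d) : Prop :=
  exists D, w D != 0.

(* a_1, ..., a_d lie in O and da_1 /\ ... /\ da_d generates, over O, the
   module of regular d-forms at O. *)
Definition local_frame (k K : fieldType) (iota : {rmorphism k -> K}) (d : nat)
    (O : set K) (a : 'I_d -> K) : Prop :=
  [/\ forall j, O (a j), nonzero_form (dwedge iota a)
    & forall b : 'I_d -> K, (forall j, O (b j)) ->
        exists2 c, O c & dwedge iota b = scale_form c (dwedge iota a)].

Definition ord_form (k K : fieldType) (iota : {rmorphism k -> K}) (d : nat)
    (O : set K) (w : diff_form iota d) : int :=
  xget 0 [set n : int | exists (a : 'I_d -> K) (f : K),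
    [/\ local_frame iota O a, w = scale_form f (dwedge iota a)
      & n = ord O f]].

(* k[x_0/x_i, ..., x_N/x_i] *)
Definition chart_ring (k K : fieldType) (iota : {rmorphism k -> K}) (N : nat)
    (x : 'I_N.+1 -> K) (i : 'I_N.+1) : set K :=
  [set mmap iota (fun j => x j / x i) p | p in [set: {mpoly k[N.+1]}]].

Definition proj_points (k K : fieldType) (iota : {rmorphism k -> K}) (N : nat)
    (x : 'I_N.+1 -> K) : set (set K) :=
  [set O | exists i p, [/\ x i != 0, prime_ideal (chart_ring iota x i) p
                         & O = localization (chart_ring iota x i) p]].

Record projective_variety (k K : fieldType) (iota : {rmorphism k -> K}) :=
  ProjectiveVariety {
    pv_dim : nat;
    pv_coord : 'I_pv_dim.+1 -> K;
    pv_coord_neq0 : exists i, pv_coord i != 0;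
    pv_generates : forall i, pv_coord i != 0 -> forall f : K,
      exists a b, [/\ chart_ring iota pv_coord i a,
                      chart_ring iota pv_coord i b, b != 0 & f = a / b];
    pv_normal : forall O, proj_points iota pv_coord O -> integrally_closed O }.
Arguments pv_coord {k K iota} p _.

Definition chart (k K : fieldType) (iota : {rmorphism k -> K})
    (X : projective_variety iota) (i : 'I_(pv_dim X).+1) : set K :=
  chart_ring iota (pv_coord X) i.
Arguments chart {k K iota} X i.

Definition points (k K : fieldType) (iota : {rmorphism k -> K})
    (X : projective_variety iota) : set (set K) :=
  proj_points iota (pv_coord X).

Definition closed_points (k K : fieldType) (iota : {rmorphism k -> K})
    (X : projective_variety iota) : set (set K) :=
  [set O | exists i m, [/\ pv_coord X i != 0,
                           maximal_ideal (chart X i) m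
                         & O = localization (chart X i) m]].

(* The locus where h != 0 in the i-th chart, for h in its coordinate ring. *)
Definition basic_open (k K : fieldType) (iota : {rmorphism k -> K})
    (X : projective_variety iota) (i : 'I_(pv_dim X).+1) (h : K) :
    set (set K) :=
  [set P | [/\ points X P, chart X i `<=` P & unit_in P h]].
Arguments basic_open {k K iota} X i h.

Definition zariski_open (k K : fieldType) (iota : {rmorphism k -> K})
    (X : projective_variety iota) (U : set (set K)) : Prop :=
  U `<=` points X /\
  forall P, U P -> exists i h,
    [/\ pv_coord X i != 0, chart X i h, basic_open X i h P
      & basic_open X i h `<=` U].

(* The generic points of the prime divisors: the points whose local ring has
   Krull dimension one. *)
Definition prime_divisors (k K : fieldType) (iota : {rmorphism k -> K})
    (X : projective_variety iota) : set (set K) :=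
  [set E | [/\ points X E, nonunits E <> [set 0]
    & forall p, prime_ideal E p -> p = [set 0] \/ p = nonunits E]].

(* A closed point has a local ring of dimension d = dim X, so this asks for
   all these local rings to be regular. *)
Definition smooth (k K : fieldType) (iota : {rmorphism k -> K})
    (d : nat) (X : projective_variety iota) : Prop :=
  forall P, closed_points X P -> exists u : 'I_d -> K,
    nonunits P = [set a | exists2 c : 'I_d -> K,
                            (forall j, P (c j)) & a = \sum_j c j * u j].

(* Only the values of D at the prime divisors of X matter. *)
Definition weil_divisor (k K : fieldType) (iota : {rmorphism k -> K})
    (X : projective_variety iota) (D : set K -> int) : Prop :=
  finite_set [set E | prime_divisors X E /\ D E != 0].

Definition effective (k K : fieldType) (iota : {rmorphism k -> K})
    (X : projective_variety iota) (D : set K -> int) : Prop :=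
  forall E, prime_divisors X E -> 0 <= D E.

(* X being normal, Cartier divisors are the locally principal Weil divisors. *)
Definition cartier (k K : fieldType) (iota : {rmorphism k -> K})
    (X : projective_variety iota) (D : set K -> int) : Prop :=
  weil_divisor X D /\
  forall P, points X P -> exists U g,
    [/\ zariski_open X U, U P, g != 0
      & forall E, prime_divisors X E -> U E -> D E = ord E g].

(* The divisor of w, on every variety with function field K at once: its
   coefficient at E depends only on the local ring E. *)
Definition canonical_divisor (k K : fieldType) (iota : {rmorphism k -> K})
    (d : nat) (w : diff_form iota d) : set K -> int :=
  fun E => ord_form E w.

Definition sections (k K : fieldType) (iota : {rmorphism k -> K})
    (X : projective_variety iota) (D : set K -> int) (U : set (set K)) :
    set K :=
  [set f | f = 0 \/
           forall E, prime_divisors X E -> U E -> 0 <= ord E f + D E].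

Definition H0 (k K : fieldType) (iota : {rmorphism k -> K})
    (X : projective_variety iota) (D : set K -> int) : set K :=
  sections X D (points X).

(* The birational map Y --> X given by the identity of K is a morphism, and
   sends the point Q to the point P dominated by Q. *)
Definition birational_morphism (k K : fieldType) (iota : {rmorphism k -> K})
    (Y X : projective_variety iota) : Prop :=
  forall Q, points Y Q -> exists2 P, points X P & dominates Q P.

Definition preimage_open (k K : fieldType) (iota : {rmorphism k -> K})
    (Y : projective_variety iota) (U : set (set K)) : set (set K) :=
  [set Q | points Y Q /\ exists2 P, U P & dominates Q P].

Definition resolution (k K : fieldType) (iota : {rmorphism k -> K}) (d : nat)
    (Y X : projective_variety iota) : Prop :=
  smooth d Y /\ birational_morphism Y X.

Definition canonical_singularities (k K : fieldType)
    (iota : {rmorphism k -> K}) (d : nat) (w : diff_form iota d)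
    (X : projective_variety iota) : Prop :=
  (exists2 r : nat, (0 < r)%N & cartier X (canonical_divisor w *+ r)) /\
  exists2 Y : projective_variety iota, resolution d Y X &
    forall m : nat, (0 < m)%N -> forall U, zariski_open X U ->
      sections Y (canonical_divisor w *+ m) (preimage_open Y U)
      = sections X (canonical_divisor w *+ m) U.

(* The smooth projective models of a variety with function field K are the
   smooth projective varieties with function field K, hence X does not occur
   otherwise than through K. *)
Definition negative_kodaira_dimension (k K : fieldType)
    (iota : {rmorphism k -> K}) (d : nat) (w : diff_form iota d)
    (X : projective_variety iota) : Prop :=
  forall Y : projective_variety iota, smooth d Y ->
    forall n : nat, (0 < n)%N -> H0 Y (canonical_divisor w *+ n) = [set 0].

(* Main.v *)
Require Import Defs.
From mathcomp Require Import perm.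
From mathcomp Require lebesgue_measure.

(** The hypotheses force any pluricanonical section of a smooth model to vanish
    because such a section is also a section on X.  Indeed, let s be a section
    of nK on a smooth projective Y with the function field of X
    ([pluricanonical_sections]), and let E be a prime divisor of X.

    The local ring of E is a discrete valuation ring, X being normal
    ([prime_divisor_uniformizer]), so by properness it contains the local ring P
    of a closed point of Y ([valuation_center], [closed_point_below]).  Since Y
    is smooth, regular parameters u_1, ..., u_d at P have differentials that
    generate all differentials over P ([regular_diff_span]: the residue field at
    P is the base field by the Nullstellensatz, then Nakayama's lemma applies).
    Thus du is a frame at P and at every prime divisor of Y through P; writing
    w = f du, the function s f^n has no pole at these divisors, and lies in P by
    Hartogs' lemma for the normal noetherian ring P ([variety_hartogs]).  Hence
    s f^n is regular along E.  At E there is a frame dv ([local_frame_exists]),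
    and du = c dv with c regular along E, so s (f c)^n is regular along E too;
    this says that s is a section of nK at E.

    Once s is a section of nK on X, its power s^m0 is a section of m0 n K on X,
    hence of H + m0 n K as H is effective, so s^m0 = 0 and s = 0.

    The commutative algebra rests on Hilbert's basis theorem ([hilbert_basis])
    and on one argument: if g is not in a noetherian ring, the multiples of g
    have a maximal proper ideal of denominators, which is prime
    ([denominator_prime]), and at that prime a normal ring is a discrete
    valuation ring ([fractional_uniformizer]).  This yields both Hartogs' lemma
    and the discreteness of codimension one points. *)

Set Implicit Arguments.
Unset Strict Implicit.
Unset Printing Implicit Defensive.

Import Order.TTheory GRing.Theory Num.Theory.
Local Open Scope classical_set_scope.
Local Open Scope ring_scope.

(** * Subrings of a field *)

Record subring (R : nzRingType) (A : set R) : Prop := Subring {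
  sub1 : A 1;
  subB : forall a b, A a -> A b -> A (a - b);
  subM : forall a b, A a -> A b -> A (a * b) }.

Section RingClosure.

Variables (R : nzRingType) (A : set R).
Hypothesis sA : subring A.

Lemma sub0 : A 0.
Proof. by rewrite -(subrr 1); apply: (subB sA) (sub1 sA) (sub1 sA). Qed.

Lemma subN a : A a -> A (- a).
Proof. by move=> Aa; rewrite -sub0r; apply: (subB sA) sub0 Aa. Qed.

Lemma subD a b : A a -> A b -> A (a + b).
Proof. by move=> Aa Ab; rewrite -[b]opprK; apply: (subB sA) => //; apply: subN. Qed.

Lemma subX a n : A a -> A (a ^+ n).
Proof.
move=> Aa; elim: n => [|n IH]; first by rewrite expr0; apply: (sub1 sA).
by rewrite exprS; apply: (subM sA).
Qed.

Lemma sub_sum (T : Type) (r : seq T) (P : pred T) (F : T -> R) :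
  (forall i, P i -> A (F i)) -> A (\sum_(i <- r | P i) F i).
Proof.
move=> AF; apply: (big_ind A) => //; first exact: sub0.
by move=> *; apply: subD.
Qed.

Lemma sub_prod (T : Type) (r : seq T) (P : pred T) (F : T -> R) :
  (forall i, P i -> A (F i)) -> A (\prod_(i <- r | P i) F i).
Proof.
move=> AF; apply: (big_ind A) => //; first exact: (sub1 sA).
by move=> *; apply: (subM sA).
Qed.

Lemma sub_sign n : A ((-1) ^+ n).
Proof. by apply: subX => //; apply: subN => //; apply: (sub1 sA). Qed.

End RingClosure.

Lemma sub_det (R : comNzRingType) (A : set R) n (M : 'M[R]_n) :
  subring A -> (forall i j, A (M i j)) -> A (\det M).
Proof.
move=> sA AM; apply: sub_sum => // s _; apply: (subM sA) => //; first exact: sub_sign.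
by apply: sub_prod.
Qed.

Section Ideals.

Variable K : fieldType.
Implicit Types (A B I J p : set K) (a b x y : K).

Lemma ideal_mulr A I a b : ideal_of A I -> I a -> A b -> I (a * b).
Proof. by case=> _ _ _ IM Ia Ab; rewrite mulrC; apply: IM. Qed.

Lemma idealN A I a : subring A -> ideal_of A I -> I a -> I (- a).
Proof.
move=> sA [_ _ _ IM] Ia; rewrite -mulN1r; apply: IM => //.
by apply: subN => //; apply: sub1.
Qed.

Lemma idealB A I a b : subring A -> ideal_of A I -> I a -> I b -> I (a - b).
Proof.
by move=> sA iI Ia Ib; case: (iI) => _ _ ID _; apply: ID => //; apply: (idealN sA).
Qed.

Lemma ideal_sum A I (T : Type) (r : seq T) (P : pred T) (F : T -> K) :
  ideal_of A I -> (forall i, P i -> I (F i)) -> I (\sum_(i <- r | P i) F i).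
Proof. by case=> _ I0 ID _ IF; apply: (big_ind I). Qed.

(** Determinants are polynomials in their entries, so they respect congruences
    modulo an ideal. *)
Lemma det_congr A I n (M N : 'M[K]_n) : subring A -> ideal_of A I ->
  (forall i j, A (M i j)) -> (forall i j, A (N i j)) ->
  (forall i j, I (M i j - N i j)) -> I (\det M - \det N).
Proof.
move=> sA iI AM AN IMN; have [_ I0 ID IM] := iI.
pose R a b := [/\ A a, A b & I (a - b)].
have RD a b a' b' : R a b -> R a' b' -> R (a + a') (b + b').
  move=> [Aa Ab Iab] [Aa' Ab' Iab']; split; try exact: subD.
  by rewrite opprD addrACA; apply: ID.
have RM a b a' b' : R a b -> R a' b' -> R (a * a') (b * b').
  move=> [Aa Ab Iab] [Aa' Ab' Iab']; split; try exact: subM.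
  have -> : a * a' - b * b' = a * (a' - b') + b' * (a - b).
    by rewrite !mulrBr [b' * a]mulrC [b' * b]mulrC addrA subrK.
  by apply: ID; apply: IM.
have Rc a : A a -> R a a by move=> Aa; split=> //; rewrite subrr.
suff [] : R (\det M) (\det N) by [].
rewrite /determinant; apply: (big_ind2 R _ RD); first by apply: Rc; apply: sub0.
move=> s _; apply: (RM _ _ _ _); first by apply: Rc; apply: sub_sign.
by apply: (big_ind2 R _ RM) => [|i _]; [apply: Rc; apply: sub1 | split].
Qed.

End Ideals.

(** * Noetherian rings and Hilbert's basis theorem *)

Section Noetherian.

Variable K : fieldType.
Implicit Types (A B I J p : set K) (a b x y : K) (f q : {poly K}).

(** Generation is phrased through the ideals that contain the generators, which
    avoids linear combinations altogether. *)
Definition finitely_generated A I : Prop :=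
  exists gs : seq K, (forall g, g \in gs -> I g) /\
    forall J, ideal_of A J -> (forall g, g \in gs -> J g) -> I `<=` J.

Definition noetherian A : Prop :=
  forall I, ideal_of A I -> finitely_generated A I.

Lemma linear_combinations A I (n : nat) (g : 'I_n -> K) : subring A ->
  ideal_of A I -> (forall j, I (g j)) ->
  ideal_of A [set a | exists2 c : 'I_n -> K,
                        (forall j, A (c j)) & a = \sum_j c j * g j].
Proof.
move=> sA [IA I0 ID IM] Ig; split.
- move=> _ [c Ac ->]; apply: sub_sum => // j _; apply: subM => //.
  exact: IA (Ig j).
- by exists (fun=> 0); [move=> _; apply: sub0
                       | rewrite big1 // => j _; rewrite mul0r].
- move=> _ _ [c Ac ->] [c' Ac' ->]; exists (fun j => c j + c' j).
    by move=> j; apply: subD.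
  by rewrite -big_split; apply: eq_bigr => j _; rewrite mulrDl.
- move=> a _ Aa [c Ac ->]; exists (fun j => a * c j).
    by move=> j; apply: subM.
  by rewrite mulr_sumr; apply: eq_bigr => j _; rewrite mulrA.
Qed.

Lemma noetherian_generators A I : subring A -> noetherian A -> ideal_of A I ->
  exists n (g : 'I_n -> K), (forall j, I (g j)) /\
    forall a, I a -> exists2 c : 'I_n -> K,
      (forall j, A (c j)) & a = \sum_j c j * g j.
Proof.
move=> sA nA iI; have [gs [Igs gsI]] := nA I iI.
have Ig (j : 'I_(size gs)) : I (tnth (in_tuple gs) j).
  by apply: Igs; apply: mem_tnth.
exists (size gs), (tnth (in_tuple gs)); split=> //.
apply: gsI; first exact: linear_combinations Ig.
move=> _ /(tnthP (in_tuple gs)) [j ->]; exists (fun i => (i == j)%:R).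
  by move=> i; case: eqP => _; [apply: sub1 | apply: sub0].
rewrite (bigD1 j) //= eqxx mul1r big1 ?addr0 // => i /negPf->.
by rewrite mul0r.
Qed.

Lemma seq_choice (S T : eqType) (P : S -> T -> Prop) (s : seq S) :
  (forall u, u \in s -> exists v, P u v) ->
  exists vs : seq T, (forall v, v \in vs -> exists u, P u v) /\
    forall u, u \in s -> exists2 v, v \in vs & P u v.
Proof.
elim: s => [|a s IH] Ps; first by exists [::].
have [f Paf] := Ps a (mem_head _ _).
have [b sb|fs [fsP Pfs]] := IH; first by apply: Ps; rewrite inE sb orbT.
exists (f :: fs); split=> [g|b].
  by rewrite inE => /predU1P [->|/fsP //]; exists a.
rewrite inE => /predU1P [->|/Pfs [g gfs Pbg]]; first by exists f; rewrite ?mem_head.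
by exists g => //; rewrite inE gfs orbT.
Qed.

Definition poly_over A : set {poly K} := [set q | forall i, A q`_i].

Definition submodule A (M : set {poly K}) : Prop :=
  [/\ M 0, forall f g, M f -> M g -> M (f + g)
    & forall a f, A a -> M f -> M (a *: f)].

Definition leading n (M : set {poly K}) : set K :=
  [set c | exists f, [/\ M f, (size f <= n.+1)%N & f`_n = c]].

Lemma submoduleI A (M N : set {poly K}) :
  submodule A M -> submodule A N -> submodule A (M `&` N).
Proof.
move=> [M0 MD MZ] [N0 ND NZ]; split=> // [f g [Mf Nf] [Mg Ng]|a f Aa [Mf Nf]].
  by split; [apply: MD | apply: ND].
by split; [apply: MZ | apply: NZ].
Qed.

Lemma submoduleB A (M : set {poly K}) f g :
  subring A -> submodule A M -> M f -> M g -> M (f - g).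
Proof.
move=> sA [_ MD MZ] Mf Mg; apply: MD => //; rewrite -scaleN1r; apply: MZ => //.
by apply: subN => //; apply: sub1.
Qed.

Lemma ideal_leading A M n : submodule A M -> M `<=` poly_over A ->
  ideal_of A (leading n M).
Proof.
move=> [M0 MD MZ] MA; split.
- by move=> _ [f [Mf _ <-]]; apply: MA.
- by exists 0; rewrite size_poly0 coef0.
- move=> _ _ [f [Mf sf <-]] [g [Mg sg <-]]; exists (f + g).
  split; [exact: MD | | by rewrite coefD].
  by rewrite (leq_trans (size_polyD _ _)) // geq_max sf.
- move=> a _ Aa [f [Mf sf <-]]; exists (a *: f).
  split; [exact: MZ | | by rewrite coefZ].
  by rewrite (leq_trans (size_scale_leq _ _)).
Qed.

(** Cancelling a leading coefficient realized inside T lowers the degree. *)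
Lemma leading_step A (M T : set {poly K}) n f :
  subring A -> submodule A M -> submodule A T ->
  leading n M `<=` leading n (M `&` T) ->
  (forall h, M h -> (size h <= n)%N -> T h) ->
  M f -> (size f <= n.+1)%N -> T f.
Proof.
move=> sA sM sT MT Tlow Mf sf.
have [|g [[Mg Tg] sg gf]] := MT f`_n; first by exists f.
rewrite -(subrK g f); case: (sT) => _ TD _; apply: TD => //.
apply: Tlow; first exact: (submoduleB sA sM).
apply/leq_sizeP => j; rewrite leq_eqVlt => /predU1P [<-|nj].
  by rewrite coefB gf subrr.
by rewrite coefB !nth_default ?subrr // (leq_trans _ nj).
Qed.

Lemma bounded_degree_fg A (M : set {poly K}) n :
  subring A -> noetherian A -> submodule A M -> M `<=` poly_over A ->
  exists fs : seq {poly K}, (forall f, f \in fs -> M f) /\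
    forall T, submodule A T -> (forall f, f \in fs -> T f) ->
      forall f, M f -> (size f <= n)%N -> T f.
Proof.
move=> sA nA sM MA; elim: n => [|n [fs [fsM fsT]]].
  exists [::]; split=> // T [T0 _ _] _ f _; rewrite leqn0 size_poly_eq0.
  by move/eqP->.
have [as_ [asL asJ]] := nA _ (ideal_leading n sM MA).
have [gs [gsP asgs]] := seq_choice asL.
exists (fs ++ gs); split=> [f|T sT fgT].
  by rewrite mem_cat => /orP [/fsM //|/gsP [a []]].
move=> f Mf sf; apply: (leading_step sA sM sT _ _ Mf sf); last first.
  by apply: fsT => // g gfs; apply: fgT; rewrite mem_cat gfs.
apply: asJ.
  apply: ideal_leading; first exact: submoduleI.
  by move=> g [Mg _]; apply: MA.
move=> a /asgs [g ggs [Mg sg ga]]; exists g; split=> //; split=> //.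
by apply: fgT; rewrite mem_cat ggs orbT.
Qed.

Lemma mulX_iter (M : set {poly K}) f n :
  (forall g, M g -> M ('X * g)) -> M f -> M ('X^n * f).
Proof.
move=> MX Mf; elim: n => [|n IH]; first by rewrite expr0 mul1r.
by rewrite exprS -mulrA; apply: MX.
Qed.

Lemma size_mulXn_leq f m n : (size f <= m)%N -> (size ('X^n * f)%R <= n + m)%N.
Proof.
move=> sf; rewrite (leq_trans (size_polyMleq _ _)) // size_polyXn addSn /=.
by rewrite leq_add2l.
Qed.

(** The leading coefficients of all degrees form one ideal; once the degree
    exceeds that of polynomials realizing generators of this ideal, every
    leading coefficient can be cancelled. *)
Lemma hilbert_basis A (M : set {poly K}) :
  subring A -> noetherian A -> submodule A M -> M `<=` poly_over A ->
  (forall f, M f -> M ('X * f)) ->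
  exists fs : seq {poly K}, (forall f, f \in fs -> M f) /\
    forall T, submodule A T -> (forall f, T f -> T ('X * f)) ->
      (forall f, f \in fs -> T f) -> M `<=` T.
Proof.
move=> sA nA sM MA MX.
have shift N m n : (forall f, N f -> N ('X * f)) -> (m <= n)%N ->
    leading m N `<=` leading n N.
  move=> NX mn c [f [Nf sf fc]]; exists ('X^(n - m) * f); split.
  - exact: mulX_iter.
  - by rewrite (leq_trans (size_mulXn_leq _ sf)) // addnS subnK.
  - by rewrite coefXnM ltnNge leq_subr /= subKn.
pose L := [set c | exists n, leading n M c].
have iL : ideal_of A L.
  split.
  - by move=> c [n]; have [LA _ _ _] := ideal_leading n sM MA; apply: LA.
  - by exists 0%N; have [] := ideal_leading 0 sM MA.
  - move=> a b [m La] [n Lb]; exists (maxn m n).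
    have [_ _ LD _] := ideal_leading (maxn m n) sM MA; apply: LD.
      by apply: shift La; rewrite ?leq_maxl.
    by apply: shift Lb; rewrite ?leq_maxr.
  - move=> a b Aa [n Lb]; exists n.
    by have [_ _ _ LM] := ideal_leading n sM MA; apply: LM.
have [as_ [asL asJ]] := nA _ iL.
have [D asD] : exists D, forall a, a \in as_ -> leading D M a.
  elim: as_ asL {asJ} => [|a s IH] sL; first by exists 0%N.
  have [n Ln] := sL a (mem_head _ _).
  have [b sb|D HD] := IH; first by apply: sL; rewrite inE sb orbT.
  exists (maxn n D) => b; rewrite inE => /predU1P [->|/HD Lb].
    by apply: shift Ln; rewrite ?leq_maxl.
  by apply: shift Lb; rewrite ?leq_maxr.
have [fs [fsM fsT]] := bounded_degree_fg D sA nA sM MA.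
have [gs [gsP asgs]] := seq_choice asD.
exists (fs ++ gs); split=> [f|T sT TX fgT f Mf].
  by rewrite mem_cat => /orP [/fsM //|/gsP [a []]].
have [n] := ubnP (size f); elim: n f Mf => // n IH f Mf; rewrite ltnS => sf.
have [nD|] := leqP n D.
  apply: fsT sT _ _ Mf (leq_trans sf nD) => g gfs.
  by apply: fgT; rewrite mem_cat gfs.
case: n IH sf => // n IH sf Dn.
apply: (leading_step sA sM sT _ _ Mf sf) => // c Lc.
have sMT := submoduleI sM sT.
apply: asJ; last by exists n.
  by apply: ideal_leading => // g [Mg _]; apply: MA.
move=> a /asgs [g ggs [Mg sg ga]]; apply: (shift _ D n) => //.
  by move=> h [Mh Th]; split; [apply: MX | apply: TX].
exists g; split=> //; split=> //.
by apply: fgT; rewrite mem_cat ggs orbT.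
Qed.

Definition adjoin A x : set K := [set q.[x] | q in poly_over A].

Lemma poly_overC A a : subring A -> A a -> poly_over A a%:P.
Proof. by move=> sA Aa i; rewrite coefC; case: eqP => _ //; apply: sub0. Qed.

Lemma poly_overX A : subring A -> poly_over A 'X.
Proof. by move=> sA i; rewrite coefX; case: eqP => _; [apply: sub1 | apply: sub0]. Qed.

Lemma subring_poly_over A : subring A -> subring (poly_over A).
Proof.
move=> sA; split; first by rewrite -polyC1; apply: poly_overC => //; apply: sub1.
- by move=> f g Af Ag i; rewrite coefB; apply: subB.
- by move=> f g Af Ag i; rewrite coefM; apply: sub_sum => // j _; apply: subM.
Qed.

Lemma sub_adjoin A x : subring A -> A `<=` adjoin A x.
Proof. by move=> sA a Aa; exists a%:P; [apply: poly_overC | rewrite hornerC]. Qed.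

Lemma mem_adjoin A x : subring A -> adjoin A x x.
Proof. by move=> sA; exists 'X; [apply: poly_overX | rewrite hornerX]. Qed.

Lemma subring_adjoin A x : subring A -> subring (adjoin A x).
Proof.
move=> sA; split.
- by apply: sub_adjoin => //; apply: sub1.
- move=> _ _ [f Af <-] [g Ag <-]; exists (f - g); last by rewrite hornerD hornerN.
  exact: (subB (subring_poly_over sA)).
- move=> _ _ [f Af <-] [g Ag <-]; exists (f * g); last by rewrite hornerM.
  exact: (subM (subring_poly_over sA)).
Qed.

(** Ideals of the extension are pulled back to sets of polynomials, so that x
    may be algebraic over A. *)
Lemma noetherian_adjoin A x : subring A -> noetherian A ->
  noetherian (adjoin A x).
Proof.
move=> sA nA I iI.
pose lift J := [set q | poly_over A q /\ J q.[x]].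
have liftP J : ideal_of (adjoin A x) J ->
    submodule A (lift J) /\ forall f, lift J f -> lift J ('X * f).
  move=> [_ J0 JD JM]; split; last first.
    move=> f [Af Jf]; split; last first.
      by rewrite hornerM hornerX; apply: JM => //; apply: mem_adjoin.
    by apply: (subM (subring_poly_over sA)) => //; apply: poly_overX.
  split.
  - by split; [move=> i; rewrite coef0; apply: sub0 | rewrite horner0].
  - move=> f g [Af Jf] [Ag Jg]; split; last by rewrite hornerD; apply: JD.
    by move=> i; rewrite coefD; apply: subD.
  - move=> a f Aa [Af Jf]; split.
      by move=> i; rewrite coefZ; apply: subM.
    by rewrite hornerZ; apply: JM => //; apply: sub_adjoin.
have [sI IX] := liftP I iI.
have [||fs [fsI fsT]] := hilbert_basis sA nA sI; [by move=> f [] | by [] | ].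
exists [seq f.[x] | f : {poly K} <- fs]; split.
  by move=> _ /mapP [f /fsI [_ If] ->].
move=> J iJ Jfs a Ia; have [sJ JX] := liftP J iJ.
have [IA _ _ _] := iI; have [q Aq qx] := IA a Ia.
suff [] : lift J q by rewrite qx.
apply: fsT => // [f ffs|]; last by split; rewrite ?qx.
by split; [have [] := fsI f ffs | apply: Jfs; apply: map_f].
Qed.

(** A union of a nonempty chain of ideals is finitely generated, hence a member
    of the chain; so Zorn's lemma applies. *)
Lemma noetherian_maximal A (F : set (set K)) : noetherian A ->
  (forall I, F I -> ideal_of A I) -> F !=set0 ->
  exists2 I, F I & forall J, F J -> I `<=` J -> J = I.
Proof.
move=> nA Fid [I0 FI0].
(* The empty set is allowed in order to cover the union of the empty chain. *)
have [|I [PI Imax]] := @Zorn_bigcup K [set I | F I \/ I = set0].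
  move=> C CF totC /=.
  have [[c [X CX Xc]]|noX] := pselect (exists c, exists2 X, C X & X c); last first.
    by right; rewrite predeqE => c; split=> // -[X CX Xc]; case: noX; exists c, X.
  have CFi Y y : C Y -> Y y -> F Y.
    by move=> CY Yy; case: (CF Y CY) => // Y0; move: Yy; rewrite Y0.
  pose U := \bigcup_(X in C) X.
  have iU : ideal_of A U.
    split.
    - move=> y [Y CY Yy]; have [YA _ _ _] := Fid _ (CFi _ _ CY Yy); exact: YA.
    - by exists X => //; have [] := Fid _ (CFi _ _ CX Xc).
    - move=> a b [Y CY Ya] [Z CZ Zb].
      have [YZ|ZY] := totC Y Z CY CZ.
        exists Z => //; have [_ _ ID _] := Fid _ (CFi _ _ CZ Zb).
        by apply: ID => //; apply: YZ.
      exists Y => //; have [_ _ ID _] := Fid _ (CFi _ _ CY Ya).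
      by apply: ID => //; apply: ZY.
    - move=> a b Aa [Y CY Yb]; exists Y => //.
      by have [_ _ _ IM] := Fid _ (CFi _ _ CY Yb); apply: IM.
  have [gs [gsU UJ]] := nA U iU.
  have [Y [CY FY gsY]] : exists Y, [/\ C Y, F Y & forall g, g \in gs -> Y g].
    elim: gs gsU {UJ} => [|g gs IH] gsU.
      by exists X; split=> //; apply: CFi Xc.
    have [b gsb|Y [CY FY gsY]] := IH; first by apply: gsU; rewrite inE gsb orbT.
    have [Z CZ Zg] := gsU g (mem_head _ _).
    have [YZ|ZY] := totC Y Z CY CZ.
      exists Z; split=> //; first exact: CFi Zg.
      by move=> b; rewrite inE => /predU1P [->|/gsY /YZ].
    by exists Y; split=> // b; rewrite inE => /predU1P [->|/gsY //]; apply: ZY.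
  left; suff -> : \bigcup_(X in C) X = Y by [].
  by apply/seteqP; split; [apply: UJ => //; apply: Fid | move=> y Yy; exists Y].
have FI : F I.
  case: PI => // I0'; case: (Imax I0); last by left.
  rewrite I0'; split=> [y //|sub].
  by have [_ /sub] := Fid I0 FI0.
exists I => // J FJ IJ; apply/seteqP; split=> //.
by apply: contrapT => JI; apply: (Imax J); [split | left].
Qed.

End Noetherian.

(** * Localizations and discrete valuation rings *)

Section Localization.

Variable K : fieldType.
Implicit Types (A B I J O p q : set K) (a b x y : K).

Definition has_fractions A : Prop :=
  forall x, exists a b, [/\ A a, A b, b != 0 & x = a / b].

Definition local_ring O : Prop := subring O /\ ideal_of O (nonunits O).

Lemma unitM O a b : subring O -> unit_in O a -> unit_in O b -> unit_in O (a * b).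
Proof.
move=> sO [a0 Oa Oa'] [b0 Ob Ob']; split; first by rewrite mulf_neq0.
  exact: subM.
by rewrite invfM; apply: subM.
Qed.

Lemma unit1 O : subring O -> unit_in O 1.
Proof. by move=> sO; split; rewrite ?oner_eq0 ?invr1 //; apply: (sub1 sO). Qed.

Lemma unitV O a : unit_in O a -> unit_in O a^-1.
Proof. by case=> a0 Oa Oa'; split; rewrite ?invr_eq0 ?invrK. Qed.

Lemma unit_exprz O a (n : int) : subring O -> unit_in O a -> unit_in O (a ^ n).
Proof.
move=> sO ua.
have uX m : unit_in O (a ^+ m).
  elim: m => [|m IH]; first by rewrite expr0; apply: unit1.
  by rewrite exprS; apply: unitM.
by case: n => m; [apply: uX | rewrite NegzE -exprnN; apply: unitV].
Qed.

Lemma nonunitN1 O : subring O -> ~ nonunits O 1.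
Proof. by move=> sO [_]; apply; apply: unit1. Qed.

Lemma unit_or_nonunit O a : O a -> unit_in O a \/ nonunits O a.
Proof. by move=> Oa; have [|nu] := pselect (unit_in O a); [left | right]. Qed.

Lemma nonunits_mul O a b : subring O -> O a -> nonunits O b -> nonunits O (a * b).
Proof.
move=> sO Oa [Ob nub]; split; first exact: subM.
case=> ab0 _ Oab; apply: nub; split=> //.
  by apply: contraNneq ab0 => ->; rewrite mulr0.
have a0 : a != 0 by apply: contraNneq ab0 => ->; rewrite mul0r.
have -> : b^-1 = a * (a * b)^-1 by rewrite invfM mulrA mulfV // mul1r.
exact: subM.
Qed.

Lemma nonunits_prime O : local_ring O -> prime_ideal O (nonunits O).
Proof.
move=> [sO mO]; split=> //; first exact: nonunitN1.
move=> a b Oa Ob [_ nab].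
have [ua|] := unit_or_nonunit Oa; last by left.
have [ub|] := unit_or_nonunit Ob; last by right.
by case: nab; apply: unitM.
Qed.

Lemma prime_nonunits O p : prime_ideal O p -> p `<=` nonunits O.
Proof.
move=> [ip p1 _] a pa; split; first by have [pO _ _ _] := ip; apply: pO.
move=> [a0 _ Oa]; apply: p1; rewrite -(mulfV a0).
exact: ideal_mulr pa Oa.
Qed.

Lemma prime_contract A B p : subring A -> A `<=` B -> prime_ideal B p ->
  prime_ideal A (A `&` p).
Proof.
move=> sA AB [[_ p0 pD pM] p1 pP]; split; last 2 first.
- by case.
- move=> a b Aa Ab [_ pab].
  by have [] := pP a b (AB a Aa) (AB b Ab) pab; [left | right].
split.
- by move=> a [].
- by split=> //; apply: sub0.
- by move=> a b [Aa pa] [Ab pb]; split; [apply: subD | apply: pD].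
- by move=> a b Aa [Ab pb]; split; [apply: subM | apply: pM => //; apply: AB].
Qed.

Lemma ideal_contract A B I : subring A -> A `<=` B -> ideal_of B I ->
  ideal_of A (A `&` I).
Proof.
move=> sA AB [_ I0 ID IM]; split.
- by move=> a [].
- by split=> //; apply: sub0.
- by move=> a b [Aa Ia] [Ab Ib]; split; [apply: subD | apply: ID].
- by move=> a b Aa [Ab Ib]; split; [apply: subM | apply: IM => //; apply: AB].
Qed.

Section AtPrime.

Variables A p : set K.
Hypotheses (sA : subring A) (pP : prime_ideal A p).

Let Ap := localization A p.

Lemma prime_sub : p `<=` A. Proof. by have [[]] := pP. Qed.

Lemma prime0 : p 0. Proof. by have [[]] := pP. Qed.

Lemma notin_prime_neq0 s : ~ p s -> s != 0.
Proof. by move=> ps; apply/eqP => s0; apply: ps; rewrite s0; apply: prime0. Qed.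

Lemma notin_primeM s u : A s -> A u -> ~ p s -> ~ p u -> ~ p (s * u).
Proof. by have [_ _ pPr] := pP => As Au ns nu /(pPr _ _ As Au) []. Qed.

Lemma sub_localization : A `<=` Ap.
Proof.
move=> a Aa; exists a, 1; have [_ p1 _] := pP.
by split; rewrite ?divr1 //; apply: (sub1 sA).
Qed.

Lemma subring_localization : subring Ap.
Proof.
split; first by apply: sub_localization; apply: sub1.
- move=> _ _ [a [s [Aa As ns ->]]] [b [u [Ab Au nu ->]]].
  exists (a * u - b * s), (s * u); split; last 2 first.
  + exact: notin_primeM.
  + rewrite -mulNr addf_div ?mulNr //; exact: notin_prime_neq0.
  + by apply: (subB sA); apply: (subM sA).
  + exact: (subM sA).
- move=> _ _ [a [s [Aa As ns ->]]] [b [u [Ab Au nu ->]]].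
  exists (a * b), (s * u); split; last by rewrite mulf_div.
  + exact: (subM sA).
  + exact: (subM sA).
  + exact: notin_primeM.
Qed.

Lemma localization_unit s : A s -> ~ p s -> unit_in Ap s.
Proof.
move=> As ns; split; [exact: notin_prime_neq0 | exact: sub_localization|].
by exists 1, s; split=> //; [apply: (sub1 sA) | rewrite div1r].
Qed.

Lemma localization_nonunit a s : A s -> ~ p s -> p a -> nonunits Ap (a / s).
Proof.
move=> As ns pa; have Aa := prime_sub pa; split; first by exists a, s.
move=> [as0 _ [b [u [Ab Au nu]]]]; rewrite invf_div => E.
have a0 : a != 0 by apply: contraNneq as0 => ->; rewrite mul0r.
apply: (notin_primeM As Au ns nu).
have -> : s * u = b * a.
  by apply/eqP; rewrite -eqr_div ?(notin_prime_neq0 nu) //; apply/eqP.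
by have [[_ _ _ pM] _ _] := pP; apply: pM.
Qed.

Lemma localization_nonunitP x : nonunits Ap x ->
  exists a s, [/\ p a, A s, ~ p s & x = a / s].
Proof.
move=> [[a [s [Aa As ns ->]]] nu]; exists a, s; split=> //.
apply: contrapT => na; apply: nu.
apply: unitM; first exact: subring_localization.
  exact: localization_unit.
by apply: unitV; apply: localization_unit.
Qed.

Lemma nonunits_localization : A `&` nonunits Ap = p.
Proof.
apply/seteqP; split=> [a [Aa [_ nu]]|a pa].
  by apply: contrapT => na; apply: nu; apply: localization_unit.
split; first exact: prime_sub.
have [_ p1 _] := pP.
by rewrite -[a]divr1; apply: localization_nonunit => //; apply: (sub1 sA).
Qed.

Lemma local_localization : local_ring Ap.
Proof.
have sAp := subring_localization; split=> //; split.
- by move=> a [].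
- by have := prime0; rewrite -nonunits_localization => -[].
- move=> x y /localization_nonunitP [a [s [pa As ns ->]]].
  move=> /localization_nonunitP [b [u [pb Au nu ->]]].
  have [[_ _ pD pM] _ _] := pP.
  rewrite addf_div; [|exact: notin_prime_neq0|exact: notin_prime_neq0].
  apply: localization_nonunit; [exact: (subM sA) | exact: notin_primeM|].
  by apply: pD; rewrite mulrC; apply: pM.
- by move=> x y Ax; apply: nonunits_mul.
Qed.

Lemma localization_min O : subring O -> A `<=` O ->
  (forall s, A s -> ~ p s -> unit_in O s) -> Ap `<=` O.
Proof.
move=> sO AO sU _ [a [s [Aa As ns ->]]].
by have [_ _ Os] := sU s As ns; apply: (subM sO) => //; apply: AO.
Qed.

Lemma has_fractions_localization : has_fractions A -> has_fractions Ap.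
Proof.
move=> fA x; have [a [b [Aa Ab b0 ->]]] := fA x.
by exists a, b; split=> //; apply: sub_localization.
Qed.

Lemma noetherian_localization : noetherian A -> noetherian Ap.
Proof.
move=> nA I iI; have sub := sub_localization.
have [gs [gsI Igs]] := nA _ (ideal_contract sA sub iI).
exists gs; split=> [g /gsI []//|J iJ Jgs x Ix].
have [IAp _ _ IM] := iI; have [a [s [Aa As ns xE]]] := IAp x Ix.
have Ia : I a.
  have -> : a = s * x by rewrite xE mulrC divfK // (notin_prime_neq0 ns).
  by apply: IM => //; apply: sub.
have [_ Ja] : (A `&` J) a.
  apply: Igs; [exact: ideal_contract iJ | | by []].
  by move=> g ggs; split; [have [] := gsI g ggs | apply: Jgs].
rewrite xE; apply: (ideal_mulr iJ) => //.
by have [] := localization_unit As ns.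
Qed.

(** Lets a prime ideal found in a local ring of a variety be read as another
    point of the same chart. *)
Lemma localization_localization q : prime_ideal Ap q ->
  [/\ prime_ideal A (A `&` q), A `&` q `<=` p
    & localization Ap q = localization A (A `&` q)].
Proof.
move=> qP; have sub := sub_localization; have [[_ _ _ qM] _ _] := qP.
split; first exact: prime_contract qP.
  move=> a [Aa qa]; rewrite -nonunits_localization; split=> //.
  exact: prime_nonunits qP _ qa.
apply/seteqP; split.
  move=> _ [x [y [[a [s [Aa As ns ->]]] [b [u [Ab Au nu ->]]] nq ->]]].
  have Aps : Ap s^-1 by have [] := localization_unit As ns.
  have Apu : Ap u^-1 by have [] := localization_unit Au nu.
  have qn v : A v -> ~ p v -> ~ q v.
    move=> Av nv qv; have [_ q1 _] := qP; apply: q1.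
    rewrite -(mulVf (notin_prime_neq0 nv)); apply: qM => //.
    by have [] := localization_unit Av nv.
  exists (a * u), (s * b); split; [exact: (subM sA)|exact: (subM sA)| |].
    move=> [_ qsb]; apply: nq.
    have [_ _ qPr] := qP.
    have [qs|qb] := qPr s b (sub _ As) (sub _ Ab) qsb; first by case: (qn s As ns).
    by rewrite mulrC; apply: qM.
  by rewrite invf_div mulf_div.
move=> _ [a [s [Aa As ns ->]]]; exists a, s; split=> //; try exact: sub.
by move=> qs; apply: ns.
Qed.

End AtPrime.

Lemma localizationS A p q : q `<=` p -> localization A p `<=` localization A q.
Proof. by move=> qp _ [a [s [Aa As ns ->]]]; exists a, s; split=> // /qp. Qed.

(** * Uniformizers *)

(** For a local ring O, this makes O a discrete valuation ring with field of
    fractions K; the expansion of every x in K in terms of t is what computes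
    orders. *)
Definition uniformizer O t : Prop :=
  [/\ nonunits O t, t != 0
    & forall x, x != 0 -> exists u (n : int), unit_in O u /\ x = u * t ^ n].

Section Valuation.

Variables (O : set K) (t : K).
Hypotheses (lO : local_ring O) (tO : uniformizer O t).

Let sO : subring O. Proof. by case: lO. Qed.
Let t0 : t != 0. Proof. by case: tO. Qed.
Let mt : nonunits O t. Proof. by case: tO. Qed.

Lemma uniformizer_exprz_unit n : unit_in O (t ^ n) -> n = 0.
Proof.
have Xnu m : ~ unit_in O (t ^+ m.+1).
  have [] // : nonunits O (t ^+ m.+1).
  rewrite exprSr; apply: nonunits_mul => //; apply: subX => //.
  by case: mt.
case: n => [[|m]|m] //; first by move/Xnu.
by rewrite NegzE -exprnN => /unitV; rewrite invrK => /Xnu.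
Qed.

Lemma mem_exprz u n : unit_in O u -> O (u * t ^ n) <-> 0 <= n.
Proof.
move=> [u0 Ou Ou']; split=> [Oun|]; last first.
  by case: n => // n _; apply: (subM sO) => //; apply: subX => //; case: mt.
case: n Oun => // n; rewrite NegzE -exprnN => Oun.
suff : unit_in O t by case: mt.
split=> //; first by case: mt.
have -> : t^-1 = u^-1 * (u * t ^- n.+1) * t ^+ n.
  by rewrite mulrA mulVf // mul1r exprS invfM -mulrA mulVf ?mulr1 // expf_neq0.
apply: (subM sO); first exact: (subM sO).
by apply: subX => //; case: mt.
Qed.

Lemma nonunits_uniformizer : nonunits O = [set t * a | a in O].
Proof.
apply/seteqP; split=> [x mx|_ [a Oa <-]]; last first.
  by rewrite mulrC; apply: nonunits_mul.
have [Ox nux] := mx; have [->|x0] := eqVneq x 0.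
  by exists 0; [apply: sub0 | rewrite mulr0].
have [_ _ tP] := tO; have [u [n [uu xE]]] := tP x x0.
have n0 : 0 <= n by apply/(mem_exprz n uu); rewrite -xE.
case: n n0 xE => [[|n]|n] // _ xE.
  by case: nux; rewrite xE mulr1.
exists (u * t ^+ n); last by rewrite xE mulrCA -exprS.
apply: (subM sO); first by case: uu.
by apply: subX => //; case: mt.
Qed.

(** Two uniformizers differ by a unit, so the choice made in ord is
    immaterial. *)
Lemma ord_uniformizer u n : unit_in O u -> ord O (u * t ^ n) = n.
Proof.
move=> uu; rewrite /ord; set S := [set _ | _].
have Sn : S n by exists u, t; split=> //; apply: nonunits_uniformizer.
case: xgetP => [m _ [v [t' [uv t'0 mt' E]]]|/(_ n)//].
have [a Oa ta] : [set t * a | a in O] t'.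
  by rewrite -nonunits_uniformizer mt'; exists 1; rewrite ?mulr1 //; apply: (sub1 sO).
have [b Ob tb] : [set t' * a | a in O] t by rewrite -mt'.
have ab : a * b = 1 by apply: (mulfI t0); rewrite mulrA ta tb mulr1.
have a0 : a != 0 by apply: contraNneq t'0 => a0; rewrite -ta a0 mulr0.
have ua : unit_in O a.
  by split=> //; rewrite -[a^-1]mulr1 -ab mulrA mulVf // mul1r.
have u0 : u != 0 by case: uu.
apply/eqP; rewrite eq_sym -subr_eq0; apply/eqP; apply: uniformizer_exprz_unit.
have -> : t ^ (n - m) = u^-1 * (v * a ^ m).
  apply: (mulIf (expfz_neq0 m t0)); rewrite -expfzDr // subrK.
  apply: (mulfI u0); rewrite E -ta expfzMl.
  by rewrite [t ^ m * _]mulrC !mulrA mulfV // mul1r.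
apply: (unitM sO); first exact: unitV.
by apply: (unitM sO) => //; apply: unit_exprz.
Qed.

Lemma ordM x y : x != 0 -> y != 0 -> ord O (x * y) = ord O x + ord O y.
Proof.
have [_ _ tP] := tO => /tP [u [n [uu ->]]] /tP [v [m [uv ->]]].
rewrite mulrACA -expfzDr // !ord_uniformizer //; exact: unitM.
Qed.

Lemma ord1 : ord O 1 = 0.
Proof. by rewrite -(ord_uniformizer 0 (unit1 sO)) mul1r expr0z. Qed.

Lemma ordX x n : x != 0 -> ord O (x ^+ n) = ord O x *+ n.
Proof.
move=> x0; elim: n => [|n IH]; first by rewrite expr0 ord1.
by rewrite exprS ordM ?expf_neq0 // IH mulrS.
Qed.

Lemma ord_ge0 x : x != 0 -> (0 <= ord O x) <-> O x.
Proof.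
have [_ _ tP] := tO => /tP [u [n [uu ->]]].
by rewrite ord_uniformizer //; split=> /(mem_exprz n uu).
Qed.

Lemma ord_unit x : unit_in O x -> ord O x = 0.
Proof. by move=> ux; rewrite -(ord_uniformizer 0 ux) expr0z mulr1. Qed.

Lemma ordV x : x != 0 -> ord O x^-1 = - ord O x.
Proof.
move=> x0; apply/eqP; rewrite -addr_eq0; apply/eqP.
have x0' : x^-1 != 0 by rewrite invr_eq0.
by rewrite -ordM // mulVf // ord1.
Qed.

Lemma ord_le x y : x != 0 -> y != 0 -> ord O x <= ord O y -> O (y / x).
Proof.
move=> x0 y0 xy; apply/ord_ge0; first by rewrite mulf_neq0 ?invr_eq0.
by rewrite ordM ?invr_eq0 // ordV // subr_ge0.
Qed.

Lemma uniformizer_prime q : prime_ideal O q -> q = [set 0] \/ q = nonunits O.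
Proof.
move=> qP; have [[_ q0 _ qM] q1 qPr] := qP.
have [[x qx x0]|qz] := pselect (exists2 x, q x & x != 0); last first.
  left; apply/seteqP; split=> [x qx|_ -> //].
  by apply/eqP; apply: contrapT => /negP x0; apply: qz; exists x.
right; apply/seteqP; split; first exact: prime_nonunits.
have Ot : O t by case: mt.
have Ox : O x by have [[qO _ _ _] _ _] := qP; apply: qO.
have qt : q t.
  have [_ _ tP] := tO; have [u [n [uu xE]]] := tP x x0.
  have n0 : 0 <= n by apply/(mem_exprz n uu); rewrite -xE.
  case: n n0 xE => // n _ xE.
  have qtn : q (t ^+ n).
    have [u0 _ Ou'] := uu.
    by rewrite -[t ^+ n]mul1r -(mulVf u0) -mulrA -/(exprz t n) -xE; apply: qM.
  elim: n qtn {xE} => [|n IH]; first by rewrite expr0.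
  by rewrite exprS => /qPr [||//|/IH//]; last exact: subX.
rewrite nonunits_uniformizer => _ [a Oa <-].
by rewrite mulrC; apply: qM.
Qed.

End Valuation.
End Localization.

(** * Valuation rings from normality *)

Section Normality.

Variable K : fieldType.
Implicit Types (A B I J O p q : set K) (a b g h x y : K).

(** A maximal element among the proper ideals of denominators of the multiples
    of g is prime. *)
Lemma denominator_prime B g : subring B -> noetherian B -> ~ B g ->
  exists p h, [/\ prime_ideal B p, ~ localization B p g, ~ localization B p h
    & forall a, p a -> B (a * h)].
Proof.
move=> sB nB Bg.
pose F := [set I | exists b, [/\ B b, ~ B (b * g)
                               & I = [set a | B a /\ B (a * (b * g))]]].
have [I [b [Bb _ ->]]||p [b [Bb nbg pE]] pmax] := @noetherian_maximal K B F nB.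
- split=> [a []//||x y [Bx Bx'] [By By']|x y Bx [By By']].
  + by split; rewrite ?mul0r; apply: sub0.
  + by split; rewrite ?mulrDl; apply: subD.
  + by split; rewrite -?mulrA; apply: subM.
- by exists [set a | B a /\ B (a * (1 * g))], 1; split=> //;
    [apply: (sub1 sB) | rewrite mul1r].
have iI : ideal_of B p.
  rewrite pE; split=> [a []//||x y [Bx Bx'] [By By']|x y Bx [By By']].
  + by split; rewrite ?mul0r; apply: sub0.
  + by split; rewrite ?mulrDl; apply: subD.
  + by split; rewrite -?mulrA; apply: subM.
exists p, (b * g); split.
- split=> //; first by rewrite pE => -[_]; rewrite mul1r.
  move=> x y Bx By pxy; have [py|npy] := pselect (p y); [by right | left].
  have ybg : ~ B (y * b * g) by move=> Bybg; apply: npy; rewrite pE; split; rewrite ?mulrA.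
  have E : [set a | B a /\ B (a * (y * b * g))] = p.
    apply: pmax.
      by exists (y * b); split=> //; apply: (subM sB).
    rewrite pE => a [Ba Babg]; split=> //.
    have -> : a * (y * b * g) = y * (a * (b * g)).
      by rewrite -!mulrA mulrCA.
    exact: (subM sB).
  rewrite -E; split=> //; move: pxy; rewrite pE => -[_].
  by rewrite !mulrA.
- move=> [a [s [Ba Bs ns gE]]]; apply: ns; rewrite pE; split=> //.
  have s0 : s != 0 by apply: contra_not_neq Bg => s0; rewrite gE s0 invr0 mulr0;
    apply: sub0.
  by rewrite gE mulrCA [s * _]mulrC divfK //; apply: (subM sB).
- move=> [a [s [Ba Bs ns hE]]]; apply: ns; rewrite pE; split=> //.
  have s0 : s != 0 by apply: contra_not_neq nbg => s0; rewrite hE s0 invr0 mulr0;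
    apply: sub0.
  by rewrite hE [s * _]mulrC divfK.
- by move=> a; rewrite pE => -[].
Qed.

Lemma char_poly_over O n (C : 'M[K]_n) : subring O -> (forall i j, O (C i j)) ->
  poly_over O (char_poly C).
Proof.
move=> sO OC; apply: sub_det; first exact: subring_poly_over.
have sP := subring_poly_over sO.
move=> i j; rewrite !mxE; apply: (subB sP); last exact: poly_overC.
by case: (i == j); [apply: poly_overX | apply: sub0].
Qed.

(** If h maps the maximal ideal into itself, then h is integral over O by the
    determinant trick; otherwise the maximal ideal is generated by the inverse
    of h. *)
Lemma fractional_uniformizer O h : local_ring O -> noetherian O ->
  integrally_closed O -> ~ O h ->
  (exists2 a, nonunits O a & a != 0) ->
  (forall a, nonunits O a -> O (a * h)) ->
  exists2 t, t != 0 & nonunits O = [set t * a | a in O].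
Proof.
move=> [sO mO] nO icO nh [a0 ma0 a00] mh.
have [[a [ma nmah]]|stable] :=
    pselect (exists a, nonunits O a /\ ~ nonunits O (a * h)); last first.
  case: nh; have [n [g [mg gm]]] := noetherian_generators sO nO mO.
  have /choice [C CP] i : exists c : 'I_n -> K,
      (forall j, O (c j)) /\ g i * h = \sum_j c j * g j.
    have [|c Oc E] := gm (g i * h); last by exists c.
    by apply: contrapT => ngh; apply: stable; exists (g i).
  pose M : 'M[K]_n := \matrix_(j, i) C i j.
  apply: (icO h (char_poly M)); first exact: char_poly_monic.
    by apply: char_poly_over => // i j; rewrite mxE; apply: (CP j).1.
  rewrite -eigenvalue_root_char; apply/eigenvalueP.
  exists (\row_j g j).
    apply/rowP => i; rewrite !mxE mulrC (CP i).2.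
    by apply: eq_bigr => j _; rewrite !mxE mulrC.
  apply: contraNneq a00 => g0; have [c _ ->] := gm a0 ma0.
  apply/eqP; rewrite big1 // => j _.
  by have /rowP/(_ j) := g0; rewrite !mxE => ->; rewrite mulr0.
have [[ah0 _ Oah]|//] := unit_or_nonunit (mh a ma).
have h0 : h != 0 by apply: contraNneq ah0 => ->; rewrite mulr0.
have a0' : a != 0 by apply: contraNneq ah0 => ->; rewrite mul0r.
have mh' : nonunits O h^-1.
  have -> : h^-1 = (a * h)^-1 * a by rewrite invfM mulrAC mulVf // mul1r.
  exact: nonunits_mul.
exists h^-1; first by rewrite invr_eq0.
apply/seteqP; split=> [b mb|_ [b Ob <-]].
  by exists (b * h); [apply: mh | rewrite mulrCA mulVf ?mulr1].
by rewrite mulrC; apply: nonunits_mul.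
Qed.

(** Dividing x by t as long as possible stops, as the ideals generated by the
    quotients increase strictly. *)
Lemma principal_uniformizer O t : local_ring O -> noetherian O ->
  has_fractions O -> t != 0 -> nonunits O = [set t * a | a in O] ->
  uniformizer O t.
Proof.
move=> [sO mO] nO fO t0 tE.
have mt : nonunits O t by rewrite tE; exists 1; rewrite ?mulr1 //; apply: (sub1 sO).
have Oint x : O x -> x != 0 -> exists u (n : nat), unit_in O u /\ x = u * t ^+ n.
  move=> Ox x0.
  pose F := [set I | exists b (n : nat), [/\ O b, x = b * t ^+ n
                                           & I = [set b * a | a in O]]].
  have [_ [b [n [Ob _ ->]]]||_ [b [n [Ob xE ->]]] bmax] := @noetherian_maximal K O F nO.
  - split.
    + by move=> _ [a Oa <-]; apply: (subM sO).
    + by exists 0; [apply: sub0 | rewrite mulr0].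
    + move=> _ _ [a Oa <-] [c Oc <-]; exists (a + c); first exact: subD.
      by rewrite mulrDr.
    + move=> a _ Oa [c Oc <-]; exists (a * c); first exact: (subM sO).
      by rewrite mulrCA.
  - by exists [set x * a | a in O], x, 0%N; split; rewrite ?expr0 ?mulr1.
  exists b, n; split=> //.
  have [//|] := unit_or_nonunit Ob; rewrite tE => -[b' Ob' bE].
  have b'E : [set b' * a | a in O] = [set b * a | a in O].
    apply: bmax.
      by exists b', n.+1; split=> //; rewrite xE -bE exprS mulrCA mulrA.
    move=> _ [a Oa <-]; exists (t * a); last by rewrite mulrA [b' * t]mulrC bE.
    by apply: (subM sO) => //; case: mt.
  have [c Oc bc] : [set b * a | a in O] b'.
    by rewrite -b'E; exists 1; rewrite ?mulr1 //; apply: (sub1 sO).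
  have b'0 : b' != 0.
    by apply: contraNneq x0 => b'0; rewrite xE -bE b'0 mulr0 mul0r.
  case: mt => Ot []; split=> //.
  have tc : t * c = 1.
    by apply: (mulfI b'0); rewrite mulr1 mulrA [b' * t]mulrC bE.
  by rewrite -[t^-1]mulr1 -tc mulrA mulVf // mul1r.
split=> // x x0; have [a [b [Oa Ob b0 xE]]] := fO x.
have a0 : a != 0 by apply: contraNneq x0 => a0; rewrite xE a0 mul0r.
have [u [n [uu aE]]] := Oint a Oa a0.
have [v [m [uv bE]]] := Oint b Ob b0.
exists (u * v^-1), (n%:Z - m%:Z); split; first by apply: unitM => //; apply: unitV.
by rewrite xE aE bE expfzDr // -exprnN invfM mulrACA.
Qed.

Lemma normal_hartogs A q g : subring A -> noetherian A -> has_fractions A ->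
  (forall p, prime_ideal A p -> integrally_closed (localization A p)) ->
  prime_ideal A q -> ~ localization A q g ->
  exists p t, [/\ prime_ideal A p, p `<=` q, ~ localization A p g
                & uniformizer (localization A p) t].
Proof.
move=> sA nA fA icA qP ng; set B := localization A q in ng.
have sB : subring B := subring_localization sA qP.
have [P [h [PP Pg Ph hP]]] := denominator_prime sB (noetherian_localization sA qP nA) ng.
have [pP pq PE] := localization_localization sA qP PP.
set p := A `&` P in pP pq PE; rewrite PE in Pg Ph.
have sAp := subring_localization sA pP.
have lAp := local_localization sA pP.
have nAp := noetherian_localization sA pP nA.
have fAp := has_fractions_localization sA pP fA.
have [t t0 tE] : exists2 t, t != 0 &
    nonunits (localization A p) = [set t * a | a in localization A p].
  apply: (fractional_uniformizer lAp nAp (icA p pP) Ph).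
    apply: contrapT => nz; apply: Pg.
    have [a [b [Aa Ab b0 ->]]] := fA g; exists a, b; split=> // pb.
    apply: nz; exists b => //; rewrite -[b]divr1.
    by apply: localization_nonunit => //; [apply: (sub1 sA) | have [_] := pP].
  move=> x /(localization_nonunitP sA pP) [a [s [pa As ns ->]]].
  have Bah : B (a * h) by apply: hP; case: pa.
  rewrite mulrAC; apply: (subM sAp); last first.
    by have [] := localization_unit sA pP As ns.
  exact: localizationS Bah.
exists p, t; split=> //.
exact: principal_uniformizer.
Qed.

(** For a nonunit a, the inverse of a has a pole at a prime below q; dimension
    one forces this prime to be q itself. *)
Lemma codim1_uniformizer A q : subring A -> noetherian A -> has_fractions A ->
  (forall p, prime_ideal A p -> integrally_closed (localization A p)) ->
  prime_ideal A q -> nonunits (localization A q) <> [set 0] ->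
  (forall P, prime_ideal (localization A q) P ->
     P = [set 0] \/ P = nonunits (localization A q)) ->
  exists t, uniformizer (localization A q) t.
Proof.
move=> sA nA fA icA qP nz dim1; set E := localization A q.
have [sE mE] : local_ring E := local_localization sA qP.
have [a ma a0] : exists2 a, nonunits E a & a != 0.
  apply: contrapT => na; apply: nz; apply/seteqP; split=> [a ma|_ ->].
    by apply/eqP; apply: contrapT => /negP a0; apply: na; exists a.
  by have [_ m0 _ _] := mE.
have nEa : ~ E a^-1 by move=> Ea; case: ma => Ea' []; split.
have [p [t [pP pq pa tP]]] := normal_hartogs sA nA fA icA qP nEa.
suff pqE : p = q by exists t; rewrite /E -pqE.
apply/seteqP; split=> // b qb.
have lAp := local_localization sA pP.
have EAp : E `<=` localization A p by apply: localizationS.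
have [P0|PE] := dim1 _ (prime_contract sE EAp (nonunits_prime lAp)).
  have [mt t0 _] := tP.
  have [c [s [pc As ns tE]]] := localization_nonunitP sA pP mt.
  have : [set 0 : K] c.
    rewrite -P0; split; first by apply: sub_localization => //; apply: (prime_sub pP).
    by move: pc; rewrite -{1}(nonunits_localization sA pP) => -[].
  by move=> c0; move: t0; rewrite tE c0 mul0r eqxx.
rewrite -(nonunits_localization sA pP); split; first exact: (prime_sub qP).
have : nonunits E b by move: qb; rewrite -{1}(nonunits_localization sA qP) => -[].
by rewrite -PE => -[].
Qed.

End Normality.

(** * Affine coordinate rings *)

Section MaximalIdeals.

Variable K : fieldType.
Implicit Types (A I m : set K) (a b x y : K).

Lemma maximal_inverse A m b : subring A -> maximal_ideal A m -> A b -> ~ m b ->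
  exists2 z, A z & m (z * b - 1).
Proof.
move=> sA [im m1 mmax] Ab nb; have [mA m0 mD mM] := im.
pose I := [set x | exists z u, [/\ A z, m u & x = z * b + u]].
have iI : ideal_of A I.
  split.
  - move=> _ [z [u [Az mu ->]]]; apply: subD => //; last exact: mA.
    exact: (subM sA).
  - by exists 0, 0; split; rewrite ?mul0r ?addr0 //; apply: sub0.
  - move=> _ _ [z [u [Az mu ->]]] [z' [u' [Az' mu' ->]]].
    exists (z + z'), (u + u'); split; [exact: subD | exact: mD|].
    by rewrite mulrDl addrACA.
  - move=> x _ Ax [z [u [Az mu ->]]]; exists (x * z), (x * u).
    by split; [exact: (subM sA) | exact: mM | rewrite mulrDr mulrA].
have [[z [u [Az mu E]]]|nI1] := pselect (I 1).
  by exists z => //; rewrite E opprD addrA subrr sub0r; apply: (idealN sA im).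
case: nb; rewrite -(mmax I iI nI1).
  by exists 1, 0; split; rewrite ?mul1r ?addr0 //; apply: (sub1 sA).
by move=> u mu; exists 0, u; split; rewrite ?mul0r ?add0r //; apply: sub0.
Qed.

Lemma maximal_prime A m : subring A -> maximal_ideal A m -> prime_ideal A m.
Proof.
move=> sA mm; have [im m1 _] := mm; split=> // a b Aa Ab mab.
have [mb|nb] := pselect (m b); [by right | left].
have [z Az mz] := maximal_inverse sA mm Ab nb.
have -> : a = z * (a * b) - a * (z * b - 1).
  by rewrite mulrBr mulr1 opprB mulrCA addrCA subrr addr0.
by have [_ _ _ mM] := im; apply: (idealB sA im); apply: mM.
Qed.

Lemma maximal_ideal_above A I : noetherian A -> ideal_of A I -> ~ I 1 ->
  exists2 m, maximal_ideal A m & I `<=` m.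
Proof.
move=> nA iI I1.
have [||m [im m1 Im] mmax] :=
    @noetherian_maximal K A [set J | [/\ ideal_of A J, ~ J 1 & I `<=` J]] nA.
- by move=> J [].
- by exists I; split.
exists m => //; split=> // J iJ J1 mJ; apply: mmax => //.
by split=> // a /Im /mJ.
Qed.

End MaximalIdeals.

Section GeneratedAlgebra.

Variables (k K : fieldType) (iota : {rmorphism k -> K}) (n : nat) (y : 'I_n -> K).

Definition generated_algebra : set K :=
  [set mmap iota y p | p in [set: {mpoly k[n]}]].

Lemma subring_generated : subring generated_algebra.
Proof.
split.
- by exists 1; rewrite ?rmorph1.
- by move=> _ _ [p _ <-] [q _ <-]; exists (p - q); rewrite ?rmorphB.
- by move=> _ _ [p _ <-] [q _ <-]; exists (p * q); rewrite ?rmorphM.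
Qed.

Lemma generated_const c : generated_algebra (iota c).
Proof. by exists c%:MP; rewrite ?mmapC. Qed.

Lemma generated_var j : generated_algebra (y j).
Proof. by exists 'X_j; rewrite ?mmapX ?mmap1U. Qed.

Lemma generated_min (B : set K) : subring B -> (forall c, B (iota c)) ->
  (forall j, B (y j)) -> generated_algebra `<=` B.
Proof.
move=> sB Bk By _ [p _ <-]; rewrite /mmap.
apply: sub_sum => // m _; apply: (subM sB) => //; rewrite /mmap1.
by apply: sub_prod => // j _; apply: subX.
Qed.

Lemma noetherian_range : noetherian (range iota).
Proof.
move=> I [Ik I0 _ IM].
have [[x Ix x0]|nz] := pselect (exists2 x, I x & x != 0); last first.
  exists [::]; split=> // J [_ J0 _ _] _ x Ix; suff -> : x = 0 by [].
  by apply/eqP; apply: contrapT => /negP x0; apply: nz; exists x.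
exists [:: x]; split=> [g|J [_ _ _ JM] Jx z Iz]; first by rewrite inE => /eqP ->.
have [c _ cE] := Ik x Ix; have [e _ eE] := Ik z Iz.
rewrite -(divfK x0 z); apply: JM; last by apply: Jx; rewrite inE.
by exists (e / c) => //; rewrite fmorph_div eE cE.
Qed.

Lemma noetherian_generated : noetherian generated_algebra.
Proof.
(* The generators are adjoined one at a time. *)
pose B s := foldr (fun x A => adjoin A x) (range iota) s.
have sB s : subring (B s) /\ noetherian (B s).
  elim: s => [|x s [sB nB]] /=; last first.
    by split; [apply: subring_adjoin | apply: noetherian_adjoin].
  split; last exact: noetherian_range.
  split.
  - by exists 1; rewrite ?rmorph1.
  - by move=> _ _ [a _ <-] [b _ <-]; exists (a - b); rewrite ?rmorphB.
  - by move=> _ _ [a _ <-] [b _ <-]; exists (a * b); rewrite ?rmorphM.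
have kB s c : B s (iota c).
  elim: s => [|x s IH] /=; first by exists c.
  by apply: sub_adjoin => //; case: (sB s).
have memB s x : x \in s -> B s x.
  elim: s => // z s IH; rewrite inE => /predU1P [->|/IH Bx] /=.
    by apply: mem_adjoin; case: (sB s).
  by apply: sub_adjoin => //; case: (sB s).
have Bsub s : (forall x, x \in s -> generated_algebra x) ->
    B s `<=` generated_algebra.
  elim: s => [|z s IH] sG /=; first by move=> _ [c _ <-]; apply: generated_const.
  have sBG := IH (fun x sx => sG x (@mem_behead _ (z :: s) x sx)).
  move=> _ [q Bq <-]; rewrite horner_coef; apply: sub_sum => [|i _].
    exact: subring_generated.
  apply: (subM subring_generated); first by apply: sBG.
  by apply: (subX subring_generated); apply: sG; rewrite mem_head.
suff -> : generated_algebra = B (codom y) by case: (sB (codom y)).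
apply/seteqP; split.
  apply: generated_min => //; first by case: (sB (codom y)).
  by move=> j; apply: memB; apply: codom_f.
by apply: Bsub => _ /codomP [j ->]; apply: generated_var.
Qed.

End GeneratedAlgebra.

(** * The Nullstellensatz over an uncountable field *)

Lemma real_uncountable (R : realType) : ~ countable [set: R].
Proof.
move=> cR; have c01 : countable [set` `[(0 : R), 1]].
  by apply: sub_countable cR; apply: subset_card_le.
have := lebesgue_measure.countable_lebesgue_measure0 c01.
rewrite lebesgue_measure.lebesgue_measure_itv /=.
rewrite constructive_ereal.lte_fin ltr01 oppr0 constructive_ereal.adde0 => -[] /eqP.
by rewrite oner_eq0.
Qed.

Lemma infinite_fibre (R : realType) (n : R -> nat) :
  exists j, infinite_set (n @^-1` [set j]).
Proof.
apply: contrapT => /forallNP fin; apply: (@real_uncountable R).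
have -> : [set: R] = \bigcup_j (n @^-1` [set j]).
  by apply/seteqP; split=> // r _; exists (n r).
apply: bigcup_countable => // j _; apply: finite_set_countable.
by apply: contrapT; apply: fin.
Qed.

(** Polynomials of bounded degree form a finite-dimensional space. *)
Lemma mpoly_dependence (k : fieldType) (n b N : nat) (p : 'I_N -> {mpoly k[n]}) :
  (forall i, (msize (p i) <= b)%N) -> (#|{: 'X_{1.. n < b}}| < N)%N ->
  exists v : 'I_N -> k, (exists i, v i != 0) /\ \sum_i v i *: p i = 0.
Proof.
move=> pb DN; set D := #|_| in DN.
pose M : 'M[k]_(N, D) :=
  \matrix_(i, e) (p i)@_(enum_val e : 'X_{1.. n < b}).
have : kermx M != 0.
  rewrite kermx_eq0; apply/negP => /eqP rM.
  by have := rank_leq_col M; rewrite rM leqNgt DN.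
move=> /rowV0Pn [v /sub_kermxP vM v0]; exists (fun i => v 0 i); split.
  apply: contrapT => /forallNP vz; move/eqP: v0; apply; apply/rowP => i.
  by rewrite mxE; apply/eqP; apply: contrapT => /negP /(vz i).
apply/mpolyP => m; rewrite mcoeff0 raddf_sum /=.
have [mb|bm] := ltnP (mdeg m) b.
  pose e := enum_rank (BMultinom mb).
  have /rowP/(_ e) := vM; rewrite !mxE => vMe; rewrite -[RHS]vMe; apply: eq_bigr => i _.
  by rewrite mcoeffZ mxE enum_rankK.
rewrite big1 // => i _; rewrite mcoeffZ memN_msupp_eq0 ?mulr0 //.
by apply: msize_mdeg_ge; apply: leq_trans bm.
Qed.

(** If a were not congruent to any constant, then a - c would have an inverse
    z_c modulo m for each of the uncountably many constants c; infinitely many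
    z_c are represented by polynomials of one degree, hence satisfy a linear
    relation.  Clearing denominators, a is algebraic modulo m. *)
Lemma nullstellensatz (R : realType) (K : fieldType)
    (iota : {rmorphism R[i] -> K}) (n : nat) (y : 'I_n -> K) (m : set K) (a : K) :
  let A := generated_algebra iota y in
  maximal_ideal A m -> A a -> exists c, m (a - iota c).
Proof.
move=> A mm Aa; have sA : subring A := subring_generated iota y.
have [im m1 _] := mm; have [mA m0 mD mM] := im.
have [_ _ mP] := maximal_prime sA mm.
have Ac c : A (a - iota c) by apply: (subB sA) => //; apply: generated_const.
apply: contrapT => /forallNP na.
have /choice [p pP] c : exists p : {mpoly R[i][n]},
    m (mmap iota y p * (a - iota c) - 1).
  by have [_ [p _ <-] mp] := maximal_inverse sA mm (Ac c) (na c); exists p.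
have [b binf] := infinite_fibre (fun r : R => msize (p r%:C%C)).
have [S Sb DS] := infinite_set_fset (#|{: 'X_{1.. n < b}}|.+1) binf.
pose s := finmap.enum_fset S; pose N := size s.
pose c (i : 'I_N) : R[i] := ((tnth (in_tuple s) i)%:C)%C.
have c_inj : injective c.
  have us : uniq (in_tuple s) by apply: finmap.fset_uniq.
  by move=> i j [] /(tuple_uniqP _ us).
have pb i : (msize (p (c i)) <= b)%N.
  have -> : msize (p (c i)) = b by apply: (Sb (tnth (in_tuple s) i)); apply: mem_tnth.
  by [].
have [v [[i0 vi0] vp]] := mpoly_dependence pb DS.
(* The relation sum_i v_i / (a - c_i) = 0 modulo m, multiplied by the product
   of all a - c_l, reads Q(a) = 0. *)
pose Q : {poly R[i]} := \sum_i v i *: \prod_(l | l != i) ('X - (c l)%:P).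
have Q0 : Q != 0.
  apply: contraNneq vi0 => Q0; have := horner0 (c i0); rewrite -Q0 horner_sum.
  rewrite (bigD1 i0) //= [X in _ + X]big1 ?addr0 => [|i ii0]; last first.
    rewrite hornerZ horner_prod (bigD1 i0) 1?eq_sym //= hornerXsubC subrr.
    by rewrite mul0r mulr0.
  rewrite hornerZ horner_prod => /eqP; rewrite mulf_eq0 => /orP [//|].
  rewrite prodf_seq_eq0 => /hasP [l _ /andP [li0]].
  rewrite hornerXsubC subr_eq0 => /eqP /c_inj li; by rewrite li eqxx in li0.
have mQ : m (map_poly iota Q).[a].
  pose T i := \prod_(l | l != i) (a - iota (c l)).
  have QE : (map_poly iota Q).[a] = \sum_i iota (v i) * T i.
    rewrite rmorph_sum horner_sum; apply: eq_bigr => i _.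
    rewrite /= map_polyZ hornerZ rmorph_prod horner_prod; congr (_ * _).
    by apply: eq_bigr => l _; rewrite rmorphB /= map_polyX map_polyC hornerXsubC.
  have z0 : \sum_i iota (v i) * mmap iota y (p (c i)) = 0.
    have := mmap0 y iota; rewrite -vp raddf_sum => E0; rewrite -[RHS]E0.
    by apply: eq_bigr => i _; rewrite /= mmapZ.
  have -> : (map_poly iota Q).[a] = - \sum_i (iota (v i) * T i) *
      (mmap iota y (p (c i)) * (a - iota (c i)) - 1).
    rewrite -sumrN QE.
    pose W := \prod_l (a - iota (c l)).
    have zW : \sum_i iota (v i) * mmap iota y (p (c i)) * W = 0.
      by rewrite -mulr_suml z0 mul0r.
    rewrite -[LHS]subr0 -[X in _ - X]zW -sumrB; apply: eq_bigr => i _.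
    rewrite /W (bigD1 i) //= -/(T i) mulrBr mulr1 opprB; congr (_ - _).
    by rewrite -!mulrA [X in _ = _ * X]mulrC -mulrA.
  apply: (idealN sA im); apply: (@ideal_sum _ A m) => // i _. apply: mM => //.
  apply: (subM sA); first exact: generated_const.
  exact: sub_prod.
have [rs QE] := closed_field_poly_normal Q.
move: mQ; rewrite QE map_polyZ hornerZ rmorph_prod horner_prod => mQ.
have lc0 : iota (lead_coef Q) != 0 by rewrite fmorph_eq0 lead_coef_eq0.
have : m (\prod_(z <- rs) (a - iota z)).
  rewrite -(mulKf lc0 (\prod_(z <- rs) _)) -fmorphV; apply: mM.
    exact: generated_const.
  move: mQ; congr (m (_ * _)); apply: eq_bigr => z _.
  by rewrite rmorphB /= map_polyX map_polyC hornerXsubC.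
elim: rs {QE mQ} => [|z rs IH]; first by rewrite big_nil.
rewrite big_cons => /mP [||/na//|//]; first exact: Ac.
exact: sub_prod.
Qed.

(** * Differentials *)

Section Differentials.

Variables (k K : fieldType) (iota : {rmorphism k -> K}).
Implicit Types (O : set K) (a b x : K) (D : vector_field iota).

Lemma derD D a b : sval D (a + b) = sval D a + sval D b.
Proof. by case: D => D [dC dD dM] /=. Qed.

Lemma derM D a b : sval D (a * b) = a * sval D b + b * sval D a.
Proof. by case: D => D [dC dD dM] /=. Qed.

Lemma derC D c : sval D (iota c) = 0.
Proof. by case: D => D [dC dD dM] /=. Qed.

Lemma der0 D : sval D 0 = 0.
Proof. by rewrite -[X in sval D X](rmorph0 iota) derC. Qed.

Lemma derN D a : sval D (- a) = - sval D a.
Proof. by apply/eqP; rewrite -addr_eq0 -derD addNr der0 eqxx. Qed.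

Lemma derB D a b : sval D (a - b) = sval D a - sval D b.
Proof. by rewrite derD derN. Qed.

Lemma der_sum D (T : Type) (r : seq T) (F : T -> K) :
  sval D (\sum_(i <- r) F i) = \sum_(i <- r) sval D (F i).
Proof.
by elim: r => [|i r IH]; rewrite ?big_nil ?der0 // !big_cons derD IH.
Qed.

Lemma derV D a : a != 0 -> sval D a^-1 = - (a^-1 * a^-1) * sval D a.
Proof.
move=> a0; have : sval D (a * a^-1) = 0 by rewrite mulfV // -(rmorph1 iota) derC.
rewrite derM => /eqP; rewrite addr_eq0 => /eqP E.
by rewrite -(mulKf a0 (sval D _)) E mulrN mulNr mulrA.
Qed.

(** Differentials are functionals on vector fields; this places db in the
    O-module spanned by the dy_j. *)
Definition diff_span O n (y : 'I_n -> K) b : Prop :=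
  exists2 c : 'I_n -> K, forall j, O (c j)
    & forall D, sval D b = \sum_j c j * sval D (y j).

Lemma diff_spanS O O' n (y : 'I_n -> K) b :
  O `<=` O' -> diff_span O y b -> diff_span O' y b.
Proof. by move=> OO' [c Oc E]; exists c => // j; apply: OO'. Qed.

Lemma diff_span_var O n (y : 'I_n -> K) j : subring O -> diff_span O y (y j).
Proof.
move=> sO; exists (fun i => (i == j)%:R) => [i|D].
  by case: eqP => _; [apply: sub1 | apply: sub0].
rewrite (bigD1 j) //= eqxx mul1r big1 ?addr0 // => i /negPf ->.
by rewrite mul0r.
Qed.

Lemma diff_span_const O n (y : 'I_n -> K) c : subring O -> diff_span O y (iota c).
Proof.
move=> sO; exists (fun=> 0) => [j|D]; first exact: sub0.
by rewrite derC big1 // => j _; rewrite mul0r.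
Qed.

Lemma diff_spanB O n (y : 'I_n -> K) a b : subring O ->
  diff_span O y a -> diff_span O y b -> diff_span O y (a - b).
Proof.
move=> sO [c Oc cE] [e Oe eE]; exists (fun j => c j - e j) => [j|D].
  exact: (subB sO).
by rewrite derB cE eE -sumrB; apply: eq_bigr => j _; rewrite mulrBl.
Qed.

Lemma diff_spanM O n (y : 'I_n -> K) a b : subring O -> O a -> O b ->
  diff_span O y a -> diff_span O y b -> diff_span O y (a * b).
Proof.
move=> sO Oa Ob [c Oc cE] [e Oe eE].
exists (fun j => a * e j + b * c j) => [j|D].
  by apply: subD => //; apply: (subM sO).
rewrite derM cE eE !mulr_sumr -big_split; apply: eq_bigr => j _ /=.
by rewrite mulrDl !mulrA.
Qed.

Lemma diff_spanV O n (y : 'I_n -> K) a : subring O -> unit_in O a ->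
  diff_span O y a -> diff_span O y a^-1.
Proof.
move=> sO [a0 Oa Oa'] [c Oc cE].
exists (fun j => - (a^-1 * a^-1) * c j) => [j|D].
  by apply: (subM sO) => //; apply: subN => //; apply: (subM sO).
by rewrite derV // cE mulr_sumr; apply: eq_bigr => j _; rewrite mulrA.
Qed.

Lemma diff_span_trans O n p (y : 'I_n -> K) (z : 'I_p -> K) b : subring O ->
  diff_span O y b -> (forall j, diff_span O z (y j)) -> diff_span O z b.
Proof.
move=> sO [c Oc cE] sy.
have /choice [f fP] j : exists f : 'I_p -> K, (forall l, O (f l)) /\
    forall D, sval D (y j) = \sum_l f l * sval D (z l).
  by have [f Of fE] := sy j; exists f.
exists (fun l => \sum_j c j * f j l) => [l|D].
  by apply: sub_sum => // j _; apply: (subM sO) => //; apply: (fP j).1.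
rewrite cE.
under eq_bigr => j _ do rewrite (fP j).2 mulr_sumr.
rewrite exchange_big; apply: eq_bigr => l _.
by rewrite mulr_suml; apply: eq_bigr => j _; rewrite mulrA.
Qed.

Lemma diff_span_generated O n (y : 'I_n -> K) b : subring O ->
  (forall c, O (iota c)) -> (forall j, O (y j)) ->
  generated_algebra iota y b -> diff_span O y b.
Proof.
move=> sO Ok Oy Ab; pose B := [set b | O b /\ diff_span O y b].
suff [] : B b by [].
apply: generated_min Ab => [|c|j].
- split.
  + by split; [apply: sub1 | rewrite -(rmorph1 iota); apply: diff_span_const].
  + move=> a c [Oa sa] [Oc sc].
    by split; [apply: (subB sO) | apply: diff_spanB].
  + move=> a c [Oa sa] [Oc sc].
    by split; [apply: (subM sO) | apply: diff_spanM].
- by split=> //; apply: diff_span_const.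
- by split=> //; apply: diff_span_var.
Qed.

Lemma diff_span_localization n (y : 'I_n -> K) p b :
  let A := generated_algebra iota y in
  prime_ideal A p -> localization A p b -> diff_span (localization A p) y b.
Proof.
move=> A pP; have sA : subring A := subring_generated iota y.
have sAp := subring_localization sA pP; have AAp := sub_localization sA pP.
have spA a : A a -> diff_span (localization A p) y a.
  apply: diff_span_generated => // [c|j]; apply: AAp.
    exact: generated_const.
  exact: generated_var.
move=> [a [s [Aa As ns ->]]]; have us := localization_unit sA pP As ns.
apply: diff_spanM => //; first exact: AAp.
- by case: us.
- exact: spA.
- by apply: diff_spanV => //; apply: spA.
Qed.

Lemma diff_span_field n (y : 'I_n -> K) b :
  has_fractions (generated_algebra iota y) -> diff_span setT y b.
Proof.
have sT : subring [set: K] by [].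
have spA a : generated_algebra iota y a -> diff_span setT y a.
  by move=> Aa; apply: diff_span_generated.
move=> fA; have [a [c [Aa Ac c0 ->]]] := fA b.
by apply: diff_spanM => //; [apply: spA | apply: diff_spanV => //; apply: spA].
Qed.

(** * Differential forms of top degree *)

Lemma scale_formA d a b (w : diff_form iota d) :
  scale_form a (scale_form b w) = scale_form (a * b) w.
Proof. by apply: funext => D; rewrite /scale_form mulrA. Qed.

Lemma scale_form_inj d a b (w : diff_form iota d) : nonzero_form w ->
  scale_form a w = scale_form b w -> a = b.
Proof.
move=> [D wD] E; apply: (mulIf wD).
by have := congr1 (fun v : diff_form iota d => v D) E.
Qed.

Lemma dwedge_span O d (u b : 'I_d -> K) : subring O ->
  (forall j, diff_span O u (b j)) ->
  exists2 c, O c & dwedge iota b = scale_form c (dwedge iota u).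
Proof.
move=> sO sb.
have /choice [f fP] j : exists f : 'I_d -> K, (forall l, O (f l)) /\
    forall D, sval D (b j) = \sum_l f l * sval D (u l).
  by have [f Of fE] := sb j; exists f.
exists (\det (\matrix_(l, j) f j l)).
  by apply: sub_det => // i j; rewrite mxE; apply: (fP j).1.
apply: funext => D; rewrite /scale_form /dwedge mulrC -det_mulmx.
congr (\det _); apply/matrixP => i j; rewrite !mxE (fP j).2.
by apply: eq_bigr => l _; rewrite !mxE mulrC.
Qed.

(** Multilinearity; this is the Cauchy-Binet formula before equal terms are
    collected. *)
Lemma dwedge_expand d n (y : 'I_n -> K) (b : 'I_d -> K) (e : 'I_d -> 'I_n -> K) :
  (forall j D, sval D (b j) = \sum_r e j r * sval D (y r)) ->
  forall V, dwedge iota b V = \sum_(f : {ffun 'I_d -> 'I_n})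
    (\prod_j e j (f j)) * dwedge iota (fun j => y (f j)) V.
Proof.
move=> bE V; rewrite /dwedge -det_tr /determinant.
have E (f : {ffun 'I_d -> 'I_n}) :
    \det (\matrix_(i, j) sval (V i) (y (f j))) =
    \sum_(s : {perm 'I_d}) (-1) ^+ odd_perm s * \prod_j sval (V (s j)) (y (f j)).
  rewrite -det_tr; apply: eq_bigr => s _; congr (_ * _).
  by apply: eq_bigr => j _; rewrite !mxE.
rewrite [RHS](eq_bigr _ (fun f _ => congr1 _ (E f))).
under [RHS]eq_bigr => f _ do rewrite mulr_sumr.
rewrite exchange_big; apply: eq_bigr => s _ /=.
under eq_bigr => j _ do rewrite !mxE bE.
rewrite bigA_distr_bigA mulr_sumr; apply: eq_bigr => f _.
by rewrite big_split mulrCA.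
Qed.

Lemma rational_form_span d (u : 'I_d -> K) (w : diff_form iota d) :
  (forall b, diff_span setT u b) -> rational_form w ->
  exists f, w = scale_form f (dwedge iota u).
Proof.
move=> su [s ->]; have sT : subring [set: K] by [].
elim: s => [|ga s [f fE]].
  by exists 0; apply: funext => D; rewrite big_nil /scale_form mul0r.
have [c _ cE] : exists2 c, [set: K] c &
    dwedge iota ga.2 = scale_form c (dwedge iota u) by apply: dwedge_span.
exists (ga.1 * c + f); apply: funext => D; rewrite big_cons.
have := congr1 (fun v : diff_form iota d => v D) fE => /= ->.
by rewrite cE /scale_form mulrDl mulrA.
Qed.

Lemma local_frame_span O d (u : 'I_d -> K) : subring O -> (forall j, O (u j)) ->
  nonzero_form (dwedge iota u) -> (forall b, O b -> diff_span O u b) ->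
  local_frame iota O u.
Proof.
move=> sO Ou nu su; split=> // b Ob; apply: dwedge_span => // j.
exact: su.
Qed.

(** Two frames differ by a unit of O, so the choice made in ord_form is
    immaterial. *)
Lemma ord_form_frame O t d (a : 'I_d -> K) f w : local_ring O ->
  uniformizer O t -> local_frame iota O a -> f != 0 ->
  w = scale_form f (dwedge iota a) -> ord_form O w = ord O f.
Proof.
move=> lO tO [Oa na aP] f0 wE; rewrite /ord_form.
case: xgetP => [_ _ [a' [f' [[Oa' na' a'P] w'E ->]]]|]; last first.
  by move=> /(_ (ord O f)) []; exists a, f.
have [c Oc cE] := aP a' Oa'; have [c' Oc' c'E] := a'P a Oa.
have cc' : c' * c = 1.
  apply: (scale_form_inj na); rewrite -scale_formA -cE -c'E.
  by apply: funext => D; rewrite /scale_form mul1r.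
have c0 : c != 0.
  by apply/eqP => c0; move/eqP: cc'; rewrite c0 mulr0 eq_sym oner_eq0.
have uc : unit_in O c.
  by split=> //; rewrite -[c^-1]mul1r -cc' mulfK.
have fE : f = f' * c.
  by apply: (scale_form_inj na); rewrite -wE w'E cE scale_formA.
have f'0 : f' != 0 by apply: contraNneq f0 => f'0; rewrite fE f'0 mul0r.
by rewrite fE (ordM lO tO) // (ord_unit lO tO uc) addr0.
Qed.

(** Over a valuation ring, a finitely generated module of rank one is generated
    by its generator of least order. *)
Lemma local_frame_exists O t d n (y : 'I_n -> K) (u : 'I_d -> K) :
  local_ring O -> uniformizer O t -> (forall r, O (y r)) ->
  (forall b, O b -> diff_span O y b) -> (forall b, diff_span setT y b) ->
  (forall b, diff_span setT u b) -> nonzero_form (dwedge iota u) ->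
  exists v : 'I_d -> K, local_frame iota O v.
Proof.
move=> lO tO Oy sy syT su nu; have sO : subring O by case: lO.
have sT : subring [set: K] by [].
have /choice [c cE] (f : {ffun 'I_d -> 'I_n}) : exists c,
    dwedge iota (fun j => y (f j)) = scale_form c (dwedge iota u).
  by have [|c _ cE] := @dwedge_span setT d u (fun j => y (f j)) sT; [| exists c].
have coords (P : set K) (b : 'I_d -> K) : (forall j, diff_span P y (b j)) ->
    exists e : 'I_d -> 'I_n -> K, (forall j r, P (e j r)) /\
      dwedge iota b = scale_form (\sum_(f : {ffun 'I_d -> 'I_n})
                         (\prod_j e j (f j)) * c f) (dwedge iota u).
  move=> sb.
  have /choice [e eP] j : exists e : 'I_n -> K, (forall r, P (e r)) /\
      forall D, sval D (b j) = \sum_r e r * sval D (y r).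
    by have [e Pe eE] := sb j; exists e.
  exists e; split=> [j r|]; first exact: (eP j).1.
  apply: funext => D; rewrite (dwedge_expand (fun j => (eP j).2)).
  by rewrite /scale_form mulr_suml; apply: eq_bigr => f _; rewrite cE mulrA.
have [f0 cf0] : exists f, c f != 0.
  apply: contrapT => /forallNP c0.
  have [e [_ uE]] := coords setT u (fun j => syT (u j)).
  have [D uD] := nu; move/eqP: uD; apply; rewrite uE /scale_form big1 ?mul0r // => f _.
  by have /negP/negPn/eqP -> := c0 f; rewrite mulr0.
case: (Order.TotalTheory.arg_minP (P := fun f => c f != 0)
  (fun f => ord O (c f)) cf0) => f1 cf1 f1min.
exists (fun j => y (f1 j)); split=> [j|| b Ob].
- exact: Oy.
- have [D uD] := nu; exists D; rewrite cE /scale_form mulf_neq0 //.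
have [e [Oe bE]] := coords O b (fun j => sy (b j) (Ob j)).
exists (\sum_(f : {ffun 'I_d -> 'I_n}) (\prod_j e j (f j)) * (c f / c f1)).
  apply: sub_sum => // f _; apply: (subM sO); first by apply: sub_prod.
  have [->|cf] := eqVneq (c f) 0; first by rewrite mul0r; apply: sub0.
  by apply: (ord_le lO tO) => //; apply: f1min.
rewrite bE cE scale_formA; congr scale_form; rewrite mulr_suml.
by apply: eq_bigr => f _; rewrite -mulrA divfK.
Qed.

End Differentials.

(** Modulo the maximal ideal every element of P is a constant, so the du_j and
    the products of the maximal ideal with differentials span all differentials;
    Nakayama's lemma, in the form of a determinant congruent to one, removes
    the products. *)
Lemma regular_diff_span (R : realType) (K : fieldType)
    (iota : {rmorphism R[i] -> K}) (n d : nat) (y : 'I_n -> K) (m : set K)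
    (u : 'I_d -> K) :
  let A := generated_algebra iota y in let P := localization A m in
  maximal_ideal A m ->
  nonunits P = [set a | exists2 c : 'I_d -> K,
                          (forall j, P (c j)) & a = \sum_j c j * u j] ->
  forall l, diff_span iota P u (y l).
Proof.
move=> A P mm mE; have sA : subring A := subring_generated iota y.
have pm := maximal_prime sA mm.
have [sP mP] : local_ring P := local_localization sA pm.
have mu j : nonunits P (u j).
  rewrite mE; exists (fun i => (i == j)%:R) => [i|].
    by case: eqP => _; [apply: sub1 | apply: sub0].
  rewrite (bigD1 j) //= eqxx mul1r big1 ?addr0 // => i /negPf ->.
  by rewrite mul0r.
have /choice [a aP] l : exists a : 'I_d -> K, (forall j, P (a j)) /\
    forall D : vector_field iota,
      sval D (y l) = \sum_j (a j * sval D (u j) + u j * sval D (a j)).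
  have [c mc] := nullstellensatz mm (generated_var iota y l).
  have : nonunits P (y l - iota c).
    by move: mc; rewrite -{1}(nonunits_localization sA pm) => -[].
  rewrite mE => -[a Pa aE]; exists a; split=> // D.
  have -> : sval D (y l) = sval D (y l - iota c) by rewrite derB derC subr0.
  rewrite aE der_sum.
  by apply: eq_bigr => j _; rewrite derM.
have /choice [e eP] (lj : 'I_n * 'I_d) : exists e : 'I_n -> K,
    (forall r, P (e r)) /\ forall D : vector_field iota,
      sval D (a lj.1 lj.2) = \sum_r e r * sval D (y r).
  by have [e Pe eE] := diff_span_localization pm ((aP lj.1).1 lj.2); exists e.
(* In matrix form dy = B du + M dy, with the entries of M in the maximal
   ideal. *)
pose M : 'M[K]_n := \matrix_(l, r) \sum_j u j * e (l, j) r.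
pose B : 'M[K]_(n, d) := \matrix_(l, j) a l j.
have mM l r : nonunits P (M l r).
  rewrite mxE; apply: (@ideal_sum _ P) => // j _.
  by apply: (ideal_mulr mP (mu j)); apply: (eP (l, j)).1.
have P1 i j : P ((1%:M : 'M[K]_n) i j).
  by rewrite mxE; case: (i == j); [apply: (sub1 sP) | apply: sub0].
have P1M i j : P ((1%:M - M) i j).
  rewrite !mxE; apply: (subB sP).
    by have := P1 i j; rewrite mxE.
  by have [] := mM i j; rewrite mxE.
have uM : unit_in P (\det (1%:M - M)).
  have [//|md] := unit_or_nonunit (sub_det sP P1M).
  case: (nonunitN1 sP); rewrite -[1](subrK (\det (1%:M - M))).
  have [_ _ mD _] := mP; apply: mD => //; rewrite -{1}(det1 K n).
  apply: (det_congr sP mP P1 P1M) => i j.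
  by rewrite !mxE opprB addrC subrK; have := mM i j; rewrite mxE.
have unitM : 1%:M - M \in unitmx by rewrite unitmxE unitfE; case: uM.
pose C := invmx (1%:M - M) *m B.
have PC l j : P (C l j).
  rewrite mxE; apply: sub_sum => // r _; apply: (subM sP); last first.
    by rewrite mxE; apply: (aP r).1.
  rewrite /invmx unitM mxE; apply: (subM sP); first by case: uM.
  rewrite mxE; apply: (subM sP); first exact: sub_sign.
  apply: sub_det => // i' j'; have := P1M (lift r i') (lift l j').
  by rewrite !mxE.
move=> l; exists (C l) => // D.
pose Y : 'cV[K]_n := \col_r sval D (y r).
pose U : 'cV[K]_d := \col_j sval D (u j).
have YE : (1%:M - M) *m Y = B *m U.
  rewrite mulmxBl mul1mx; apply/colP => i; rewrite !mxE (aP i).2 big_split /=.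
  rewrite -addrA [X in _ + X](_ : _ = 0) ?addr0.
    by apply: eq_bigr => j _; rewrite !mxE.
  apply/eqP; rewrite subr_eq0; apply/eqP.
  under eq_bigr => j _ do rewrite (eP (i, j)).2 mulr_sumr.
  rewrite exchange_big; apply: eq_bigr => r _ /=; rewrite !mxE mulr_suml.
  by apply: eq_bigr => j _; rewrite mulrA.
have : Y = C *m U by rewrite -mulmxA -YE mulKmx.
move=> /colP /(_ l); rewrite [X in X = _]mxE => ->; rewrite [LHS]mxE.
apply: eq_bigr => j _.
by congr (_ * _); rewrite mxE.
Qed.

(** * Projective varieties *)

Section Varieties.

Variables (k K : fieldType) (iota : {rmorphism k -> K}).
Implicit Types (X Y : projective_variety iota) (E p : set K).

Lemma chartE X i :
  chart X i = generated_algebra iota (fun j => pv_coord X j / pv_coord X i).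
Proof. by []. Qed.

Lemma subring_chart X i : subring (chart X i).
Proof. by rewrite chartE; apply: subring_generated. Qed.

Lemma noetherian_chart X i : noetherian (chart X i).
Proof. by rewrite chartE; apply: noetherian_generated. Qed.

Lemma has_fractions_chart X i : pv_coord X i != 0 -> has_fractions (chart X i).
Proof. by move=> xi x; apply: pv_generates. Qed.

Lemma chart_normal X i : pv_coord X i != 0 ->
  forall p, prime_ideal (chart X i) p -> integrally_closed (localization (chart X i) p).
Proof. by move=> xi p pP; apply: (@pv_normal _ _ _ X); exists i, p. Qed.

Lemma prime_divisor_uniformizer X E : prime_divisors X E ->
  local_ring E /\ exists t, uniformizer E t.
Proof.
move=> [[i [q [xi qP ->]]] nz dim1].
split; first exact: (local_localization (subring_chart i) qP).
by apply: codim1_uniformizer => //; [exact: subring_chart | exact: noetherian_chart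
  | exact: has_fractions_chart | exact: chart_normal].
Qed.

(** Poles of functions on a normal variety have codimension one: this is how a
    condition on divisors, such as being a section, gives regularity at a
    point. *)
Lemma variety_hartogs X i q g : pv_coord X i != 0 -> prime_ideal (chart X i) q ->
  ~ localization (chart X i) q g ->
  exists p, [/\ prime_ideal (chart X i) p, p `<=` q,
                prime_divisors X (localization (chart X i) p)
              & ~ localization (chart X i) p g].
Proof.
move=> xi qP ng; have sA := subring_chart i.
have [p [t [pP pq png tP]]] := normal_hartogs sA (@noetherian_chart X i)
  (has_fractions_chart xi) (chart_normal xi) qP ng.
exists p; split=> //; split.
- by exists i, p.
- move=> m0; have [mt t0 _] := tP.
  by move: mt; rewrite m0 => /= t00; rewrite t00 eqxx in t0.
- move=> P; exact: (uniformizer_prime (local_localization sA pP) tP).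
Qed.

(** Projective space is proper: after division by the coordinate of least order
    all coordinates lie in the valuation ring. *)
Lemma valuation_center Y E t : local_ring E -> uniformizer E t ->
  (forall c, E (iota c)) -> exists2 i, pv_coord Y i != 0 & chart Y i `<=` E.
Proof.
move=> lE tE Ek; have sE : subring E by case: lE.
have [i0 yi0] := pv_coord_neq0 Y.
case: (Order.TotalTheory.arg_minP (P := fun i => pv_coord Y i != 0)
  (fun i => ord E (pv_coord Y i)) yi0) => i yi imin.
exists i => //; rewrite chartE; apply: generated_min => // j.
have [->|yj] := eqVneq (pv_coord Y j) 0; first by rewrite mul0r; apply: sub0.
by apply: (ord_le lE tE) => //; apply: imin.
Qed.

(** Smoothness is a condition at closed points, and the centre of E need not be
    closed; specializing it to a closed point only shrinks the local ring. *)
Lemma closed_point_below Y i E : local_ring E -> chart Y i `<=` E ->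
  exists2 m, maximal_ideal (chart Y i) m & localization (chart Y i) m `<=` E.
Proof.
move=> lE AE; have [sE mE] := lE; have sA := subring_chart i.
have iI := ideal_contract sA AE mE.
have [|m mm Im] := maximal_ideal_above (@noetherian_chart Y i) iI.
  by case=> _; apply: nonunitN1.
exists m => //; apply: localization_min => // s As ns.
have [//|ms] := unit_or_nonunit (AE s As).
by case: ns; apply: Im.
Qed.

End Varieties.

(** The differentials at a smooth closed point of Y below E supply a frame du
    which remains a frame at all prime divisors of Y through that point.  With
    w = f du, the function s f^n is regular at these divisors, hence at the
    point, hence along E; passing to a frame at E multiplies f by an element
    of E. *)
Lemma pluricanonical_sections (R : realType) (K : fieldType)
    (iota : {rmorphism R[i] -> K}) (d : nat) (w : diff_form iota d)
    (X Y : projective_variety iota) (n : nat) :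
  rational_form w -> nonzero_form w -> smooth d Y ->
  H0 Y (canonical_divisor w *+ n) `<=` H0 X (canonical_divisor w *+ n).
Proof.
move=> rw nw smY s sY; have [->|s0] := eqVneq s 0; first by left.
have {}sY E' : prime_divisors Y E' -> 0 <= ord E' s + ord_form E' w *+ n.
  move=> E'Y; case: sY => [s00|sY]; first by rewrite s00 eqxx in s0.
  by have := sY E' E'Y; rewrite natmulfctE; apply; case: E'Y.
right=> E EX _; rewrite natmulfctE /canonical_divisor.
have [lE [t tE]] := prime_divisor_uniformizer EX; have sE : subring E by case: lE.
have [[j [q [xj qP EE]]] _ _] := EX.
have XE : chart X j `<=` E
  by rewrite EE; apply: sub_localization => //; apply: subring_chart.
have [|i yi YE] := @valuation_center _ _ iota Y E t lE tE.
  by move=> c; apply: XE; rewrite chartE; apply: generated_const.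
have sA := subring_chart i.
have [m mm PE] := closed_point_below lE YE; have pm := maximal_prime sA mm.
have [|u mu] := smY (localization (chart Y i) m); first by exists i, m.
set P := localization (chart Y i) m in PE mu.
have sP : subring P := subring_localization sA pm.
have sT : subring [set: K] by [].
have Pu l : P (u l).
  have [] // : nonunits P (u l).
  rewrite mu; exists (fun r => (r == l)%:R) => [r|].
    by case: eqP => _; [apply: (sub1 sP) | apply: sub0].
  rewrite (bigD1 l) //= eqxx mul1r big1 ?addr0 // => r /negPf ->.
  by rewrite mul0r.
have suP := regular_diff_span mm mu.
have suT b : diff_span iota setT u b.
  apply: diff_span_trans sT (diff_span_field b (has_fractions_chart yi)) _ => r.
  by apply: diff_spanS (suP r).
have [f wE] := rational_form_span suT rw.
have [V wV] := nw.
have f0 : f != 0.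
  by apply: contraNneq wV => f0; rewrite wE f0 /scale_form mul0r.
have nu : nonzero_form (dwedge iota u).
  exists V; apply: contraNneq wV => uV; by rewrite wE /scale_form uV mulr0.
have fn0 : f ^+ n != 0 by rewrite expf_neq0.
have Pg : P (s * f ^+ n).
  apply: contrapT => ng.
  have [p [pP pm' E'Y ng']] := variety_hartogs yi pm ng; apply: ng'.
  set E' := localization _ p in E'Y *.
  have PE' : P `<=` E' by apply: localizationS.
  have [lE' [t' tE']] := prime_divisor_uniformizer E'Y.
  have sE' : subring E' by case: lE'.
  have fr : local_frame iota E' u.
    apply: local_frame_span => // [l|b E'b]; first exact: PE'.
    apply: diff_span_trans sE' (diff_span_localization pP E'b) _ => r.
    exact: diff_spanS (suP r).
  have := sY E' E'Y; rewrite (ord_form_frame lE' tE' fr f0 wE).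
  rewrite -(ordX lE' tE' n f0) -(ordM lE' tE' s0 fn0).
  by move/(ord_ge0 lE' tE' (mulf_neq0 s0 fn0)).
have [v fr] : exists v : 'I_d -> K, local_frame iota E v.
  apply: (local_frame_exists lE tE (y := fun r => pv_coord X r / pv_coord X j))
    suT nu.
  - by move=> r; apply: XE; rewrite chartE; apply: generated_var.
  - by move=> b; rewrite EE => Eb; apply: diff_span_localization.
  - by move=> b; apply: diff_span_field; apply: has_fractions_chart.
have [_ _ vP] := fr; have [c Ec uE] := vP u (fun l => PE _ (Pu l)).
have c0 : c != 0.
  have [V' uV'] := nu; apply: contraNneq uV' => c0.
  by rewrite uE c0 /scale_form mul0r.
have fc0 : f * c != 0 by rewrite mulf_neq0.
have fcn0 : (f * c) ^+ n != 0 by rewrite expf_neq0.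
rewrite (@ord_form_frame _ _ _ _ _ _ v (f * c) _ lE tE fr fc0); last first.
  by rewrite wE uE scale_formA.
rewrite -(ordX lE tE n fc0) -(ordM lE tE s0 fcn0).
apply/(ord_ge0 lE tE (mulf_neq0 s0 fcn0)).
rewrite exprMn mulrA; apply: (subM sE); first exact: PE.
exact: subX.
Qed.

Theorem proposition2 (R : realType) (K : fieldType)
    (iota : {rmorphism R[i] -> K}) (d : nat)
    (hd : transcendence_degree iota d)
    (w : diff_form iota d) (hw : rational_form w) (hw0 : nonzero_form w)
    (X : projective_variety iota)
    (hX : canonical_singularities w X)
    (H : set K -> int) (hH : cartier X H) (hHeff : effective X H)
    (m0 : nat) (hm0 : (1 <= m0)%N)
    (hvan : forall m : nat, (m0 <= m)%N ->
       H0 X (H + canonical_divisor w *+ m) = [set 0]) :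
  negative_kodaira_dimension w X.
Proof.
move=> Y smY n n0; apply/seteqP; split=> [s sY|_ ->]; last by left.
apply: contrapT => /eqP s0.
have [s00|sX] := pluricanonical_sections X hw hw0 smY sY.
  by rewrite s00 eqxx in s0.
have : [set 0 : K] (s ^+ m0).
  rewrite -(hvan (n * m0)%N); last by rewrite leq_pmull.
  right=> E EX EpX; have [lE [t tE]] := prime_divisor_uniformizer EX.
  have := sX E EX EpX; rewrite addrfctE !natmulfctE => sE.
  rewrite (ordX lE tE m0 s0) mulrnA addrCA -mulrnDl.
  by apply: addr_ge0; [apply: hHeff | apply: mulrn_wge0].
by move=> /= /eqP; rewrite expf_eq0 (negPf s0) andbF.
Qed.
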